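(* For every integer $n\ge1$ there exist a CW complex of the form $$\mathbb{CP}^{2n}\cup e^3\cup e^7\cup\dots\cup e^{4n-1},$$ obtained from $\mathbb{CP}^{2n}$ by attaching one cell in each of the dimensions $3,7,\dots,4n-1$, and a map $$\mathbb{HP}^n\to \mathbb{CP}^{2n}\cup e^3\cup e^7\cup\dots\cup e^{4n-1}$$ which is a homotopy equivalence.
   Context: $e^p$ denotes a $p$-dimensional cell. *)

(* Defs.v *)
From HB Require Import structures.
From mathcomp Require Import all_boot all_order all_algebra generic_quotient ring.
From mathcomp Require Import all_classical all_reals all_analysis.
From mathcomp Require Import complex.

Set Implicit Arguments.
Unset Strict Implicit.
Unset Printing Implicit Defensive.

Import Order.TTheory GRing.Theory Num.Theory.
Import numFieldTopology.Exports.

Local Open Scope classical_set_scope.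
Local Open Scope ring_scope.
Local Open Scope quotient_scope.
Local Open Scope complex_scope.

(* [R[i]^o] is the field [R[i]] with the topology of its norm. *)
Notation cplx R := (R[i]^o).

(* [(a, b)] stands for [a + b j], where [j * a = a^* * j] and [j * j = -1];
   the topology and the addition are those of the product. *)
Definition quat (R : realType) : Type := (cplx R * cplx R)%type.

Section quaternions.
Context {R : realType}.
Implicit Types q r s : quat R.

HB.instance Definition _ := Choice.on (quat R).
HB.instance Definition _ := Topological.copy (quat R) (cplx R * cplx R)%type.
HB.instance Definition _ := GRing.Zmodule.copy (quat R) (cplx R * cplx R)%type.

Definition qmul q r : quat R :=
  (q.1 * r.1 - q.2 * conjc r.2, q.1 * r.2 + q.2 * conjc r.1).

Definition qone : quat R := (1, 0).

Definition qnorm2 q : R[i] := q.1 * conjc q.1 + q.2 * conjc q.2.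

Definition qinv q : quat R :=
  (conjc q.1 / qnorm2 q, - q.2 / qnorm2 q).

Lemma quatP q r : q.1 = r.1 -> q.2 = r.2 -> q = r.
Proof. by case: q r => [a b] [c d] /= -> ->. Qed.

Lemma qmulA : associative qmul.
Proof.
move=> [[a1 a2] [b1 b2]] [[c1 c2] [d1 d2]] [[e1 e2] [f1 f2]].
by apply: quatP; apply/eqP; rewrite eq_complex /=; apply/andP; split;
  apply/eqP; ring.
Qed.

Lemma qmul1q : left_id qone qmul.
Proof.
move=> [[a1 a2] [b1 b2]].
by apply: quatP; apply/eqP; rewrite eq_complex /=; apply/andP; split;
  apply/eqP; ring.
Qed.

Lemma qmulq1 : right_id qone qmul.
Proof.
move=> [[a1 a2] [b1 b2]].
by apply: quatP; apply/eqP; rewrite eq_complex /=; apply/andP; split;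
  apply/eqP; ring.
Qed.

Lemma qmulDl : left_distributive qmul +%R.
Proof.
move=> [[a1 a2] [b1 b2]] [[c1 c2] [d1 d2]] [[e1 e2] [f1 f2]].
by apply: quatP; apply/eqP; rewrite eq_complex /=; apply/andP; split;
  apply/eqP; ring.
Qed.

Lemma qmulDr : right_distributive qmul +%R.
Proof.
move=> [[a1 a2] [b1 b2]] [[c1 c2] [d1 d2]] [[e1 e2] [f1 f2]].
by apply: quatP; apply/eqP; rewrite eq_complex /=; apply/andP; split;
  apply/eqP; ring.
Qed.

Lemma qone_neq0 : qone != 0.
Proof. by rewrite xpair_eqE negb_and oner_eq0. Qed.

HB.instance Definition _ := GRing.Zmodule_isNzRing.Build (quat R)
  qmulA qmul1q qmulq1 qmulDl qmulDr qone_neq0.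

Lemma qnorm2_eq0 q : (qnorm2 q == 0) = (q == 0).
Proof.
case: q => [[a b] [c d]].
have -> : qnorm2 (a +i* b, c +i* d) =
    (a ^+ 2 + b ^+ 2 + (c ^+ 2 + d ^+ 2))%:C.
  by rewrite /qnorm2; apply/eqP; rewrite eq_complex /=; apply/andP; split;
    apply/eqP; ring.
have sq0 := @sqr_ge0 R.
rewrite (inj_eq (@complexI R)) paddr_eq0 ?addr_ge0//.
by rewrite !paddr_eq0// !sqrf_eq0 !xpair_eqE !eq_complex.
Qed.

Lemma qmulVq : {in [pred q | q != 0], left_inverse 1 qinv *%R}.
Proof.
move=> q; rewrite inE -qnorm2_eq0 => q0.
apply: quatP; rewrite /GRing.mul/= /qmul/= /qinv/=.
  rewrite -[X in _ = X](divff q0) /qnorm2; ring.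
ring.
Qed.

Lemma qmulqV : {in [pred q | q != 0], right_inverse 1 qinv *%R}.
Proof.
move=> q; rewrite inE -qnorm2_eq0 => q0.
have qJ : conjc (qnorm2 q) = qnorm2 q.
  case: q {q0} => [[a b] [c d]]; apply/eqP; rewrite eq_complex /=.
  by apply/andP; split; apply/eqP; ring.
have divJ (x : R[i]) : conjc (x / qnorm2 q) = conjc x / qnorm2 q.
  have -> : conjc (x / qnorm2 q) = conjc x * conjc (qnorm2 q)^-1 by exact: rmorphM.
  by congr (_ * _); rewrite -[in RHS]qJ; exact: fmorphV.
have conjcK' (x : R[i]) : conjc (conjc x) = x by exact: conjcK.
apply: quatP; rewrite /GRing.mul/= /qmul/= /qinv/= !divJ ?conjcK'.
  rewrite -[X in _ = X](divff q0) /qnorm2 rmorphN; ring.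
ring.
Qed.

Lemma qunitP q r : r * q = 1 /\ q * r = 1 -> [pred q | q != 0] q.
Proof.
move=> [rq _] /=; apply/eqP => q0.
by move: rq; rewrite q0 mulr0 => /eqP; rewrite eq_sym oner_eq0.
Qed.

Lemma qinv_out : {in [predC [pred q | q != 0]], qinv =1 id}.
Proof.
move=> q; rewrite !inE negbK => /eqP ->.
by apply: quatP => /=; rewrite ?conjc0 ?oppr0 mul0r.
Qed.

HB.instance Definition _ := GRing.NzRing_hasMulInverse.Build (quat R)
  qmulVq qmulqV qunitP qinv_out.

End quaternions.

Section projective.
Context (D : unitRingType) (m : nat).

Definition nonzero_vec : set 'rV[D]_m := [set v | v != 0].

(* Over [R[i]] and over the quaternions the units are the nonzero elements. *)
Definition line_rel (v w : nonzero_vec) : bool :=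
  `[< exists2 a : D, a \is a GRing.unit & \val w = a *: \val v >].

Lemma line_rel_refl : reflexive line_rel.
Proof. by move=> v; apply/asboolP; exists 1; rewrite ?unitr1 ?scale1r. Qed.

Lemma line_rel_sym : symmetric line_rel.
Proof.
suff H v w : line_rel v w -> line_rel w v by move=> v w; apply/idP/idP => /H.
move=> /asboolP[a ua wE]; apply/asboolP; exists a^-1; first by rewrite unitrV.
by rewrite wE scalerA mulVr// scale1r.
Qed.

Lemma line_rel_trans : transitive line_rel.
Proof.
move=> v u w /asboolP[a ua vE] /asboolP[b ub wE].
apply/asboolP; exists (b * a); first by rewrite unitrMl.
by rewrite wE vE scalerA.
Qed.

Canonical line_equiv := EquivRel line_rel line_rel_refl line_rel_sym line_rel_trans.

End projective.

Arguments nonzero_vec : clear implicits.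

Definition CP (R : realType) (m : nat) : topologicalType :=
  quotient_topology {eq_quot line_equiv (cplx R) m.+1}.

Definition HP (R : realType) (m : nat) : topologicalType :=
  quotient_topology {eq_quot line_equiv (quat R) m.+1}.

Definition homotopic (R : realType) (X Y : topologicalType) (f g : X -> Y) :=
  exists H : X * R -> Y,
    [/\ {within [set: X] `*` `[0, 1], continuous H},
        forall x, H (x, 0) = f x & forall x, H (x, 1) = g x].

Definition homotopy_equivalence (R : realType) (X Y : topologicalType)
    (f : X -> Y) :=
  continuous f /\
  exists g : Y -> X,
    [/\ continuous g, homotopic R (g \o f) id & homotopic R (f \o g) id].

Definition sqnorm (R : realType) p (x : 'rV[R]_p) : R := \sum_i x 0 i ^+ 2.

Definition disk (R : realType) p : set 'rV[R]_p := [set x | sqnorm x <= 1].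

Definition sphere (R : realType) p : set 'rV[R]_p := [set x | sqnorm x = 1].

Arguments disk : clear implicits.
Arguments sphere : clear implicits.

(* A space with a family of candidate characteristic maps; the axioms of a
   CW complex are stated separately in [is_CW]. *)
Record cell_space (R : realType) := CellSpace {
  carrier :> topologicalType;
  cell : Type;
  dim : cell -> nat;
  char_map : forall e : cell, disk R (dim e) -> carrier
}.

Section CW.
Context {R : realType}.

Definition disk_interior p : set (disk R p) := [set x | sqnorm (\val x) < 1].

Definition disk_boundary p : set (disk R p) := [set x | sqnorm (\val x) = 1].

Definition open_cell (X : cell_space R) (e : cell X) : set X :=
  @char_map R X e @` @disk_interior (dim e).

Definition homeo_onto_image (T U : topologicalType) (A : set T) (f : T -> U) :=
  [/\ {within A, continuous f}, {in A &, injective f} &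
      forall V, open V -> exists2 W, open W & f @` (A `&` V) = f @` A `&` W].

Record is_CW (X : cell_space R) : Prop := IsCW {
  CW_hausdorff : hausdorff_space X;
  CW_continuous : forall e, continuous (@char_map R X e);
  CW_homeo : forall e,
    homeo_onto_image (@disk_interior (dim e)) (@char_map R X e);
  CW_partition : forall x : X, exists! e, open_cell e x;
  CW_closure_finite : forall e, exists J : set (cell X),
    [/\ finite_set J, (forall e', J e' -> (dim e' < dim e)%N) &
        @char_map R X e @` @disk_boundary (dim e)
          `<=` \bigcup_(e' in J) open_cell e'];
  CW_weak : forall C : set X,
    (forall e, closed (@char_map R X e @^-1` C)) -> closed C
}.

Section attach.
Context (A : cell_space R) (p : nat) (phi : sphere R p -> A).

Definition attach_summand (b : bool) : topologicalType :=
  if b then A : topologicalType else disk R p : topologicalType.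

Definition attach_sum : topologicalType := {b : bool & attach_summand b}.

Definition attach_inl (a : A) : attach_sum := existT attach_summand true a.

Definition attach_inr (x : disk R p) : attach_sum :=
  existT attach_summand false x.

(* Sends each boundary point [s] of the disk to [phi s], and fixes every other
   point; its kernel is the equivalence relation generated by [s ~ phi s]. *)
Definition attach_collapse (u : attach_sum) : attach_sum :=
  let: existT b y := u in
  match b return attach_summand b -> attach_sum with
  | true => attach_inl
  | false => fun x =>
      if insub (\val x) is Some s then attach_inl (phi s) else attach_inr x
  end y.

Definition attach_rel (u v : attach_sum) : bool :=
  attach_collapse u == attach_collapse v.

Lemma attach_rel_refl : reflexive attach_rel.
Proof. by move=> u; exact: eqxx. Qed.

Lemma attach_rel_sym : symmetric attach_rel.
Proof. by move=> u v; exact: eq_sym. Qed.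

Lemma attach_rel_trans : transitive attach_rel.
Proof. by move=> v u w /eqP uv /eqP vw; apply/eqP; rewrite uv. Qed.

Canonical attach_equiv :=
  EquivRel attach_rel attach_rel_refl attach_rel_sym attach_rel_trans.

Definition adjunction : topologicalType :=
  quotient_topology {eq_quot attach_equiv}.

Definition adjunction_pi (u : attach_sum) : adjunction :=
  \pi_{eq_quot attach_equiv} u.

Definition attach_dim (e : option (cell A)) : nat :=
  if e is Some e' then dim e' else p.

Definition attach_char (e : option (cell A)) :
    disk R (attach_dim e) -> adjunction :=
  match e return disk R (attach_dim e) -> adjunction with
  | Some e' => fun x => adjunction_pi (attach_inl (char_map x))
  | None => fun x => adjunction_pi (attach_inr x)
  end.

Definition attach_cell : cell_space R := CellSpace attach_char.

End attach.

Inductive attached : cell_space R -> seq nat -> cell_space R -> Prop :=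
| attached_nil (A : cell_space R) : attached A [::] A
| attached_cons (A : cell_space R) p (phi : sphere R p -> A) ps X :
    continuous phi -> attached (attach_cell phi) ps X -> attached A (p :: ps) X.

Section CP_cells.
Context (m : nat).

(* For [x] in the disk of dimension [2i], with complex coordinates
   [z_j = x_j + 'i x_(i+j)], the vector
   [(z_0, ..., z_(i-1), sqrt (1 - |x|^2), 0, ..., 0)]. *)
Definition CP_cell_vec (i : 'I_m.+1) (x : 'rV[R]_(i + i)) : 'rV[cplx R]_m.+1 :=
  \row_(k < m.+1)
    if insub (k : nat) is Some j then
      (x 0 (lshift i j) +i* x 0 (rshift i j) : cplx R)
    else if k == i then (Num.sqrt (1 - sqnorm x))%:C else 0.

Lemma CP_cell_vec_neq0 (i : 'I_m.+1) (x : disk R (i + i)) :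
  CP_cell_vec (\val x) \in nonzero_vec (cplx R) m.+1.
Proof.
rewrite inE /nonzero_vec /=; apply/eqP => /rowP v0.
have x0 : sqnorm (\val x) = 0.
  rewrite /sqnorm big_split_ord /= -big_split /= big1 // => j _.
  have lt_jm : (j < m.+1)%N by rewrite (ltn_trans (ltn_ord j)).
  have := v0 (Ordinal lt_jm); rewrite !mxE /= valK => /eqP.
  by rewrite eq_complex /= => /andP[/eqP -> /eqP ->]; rewrite expr0n addr0.
have := v0 i; rewrite !mxE insubF ?ltnn// eqxx x0 subr0 sqrtr1 => /eqP.
by rewrite oner_eq0.
Qed.

Definition CP_char (i : 'I_m.+1) (x : disk R (i + i)) : CP R m :=
  \pi_{eq_quot line_equiv (cplx R) m.+1}
    (exist (fun v => v \in nonzero_vec _ m.+1) _ (CP_cell_vec_neq0 x)).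

Definition CP_cells : cell_space R :=
  @CellSpace R (CP R m) 'I_m.+1 (fun i => i + i)%N CP_char.

End CP_cells.

End CW.

Arguments CP_cells : clear implicits.

(* Main.v *)
From mathcomp Require Import all_boot all_order all_algebra generic_quotient ring lra zify.
From mathcomp Require Import all_classical all_reals all_analysis.
From mathcomp Require Import complex.
Require Import Defs.

(** Let [w] be a unit row of quaternions.  The complex lines in the quaternionic
    line of [w] are those of the rows [u w] with [u] a unit quaternion, and the
    line of [u w] is determined by the unit imaginary quaternion conj(u) i u.
    So CP^(2n-1) is a bundle of 2-spheres over HP^(n-1).  Allowing every
    imaginary [q] with |q| <= 1 fills these spheres with 3-balls.  The complex
    [X] is the union of CP^(2n) and of this ball bundle over HP^(n-1).

    Cells.  Over the open 4k-cell of HP^(n-1) the ball bundle is a product.  Its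
    sphere bundle consists of the cells of dimension 4k and 4k+2 of CP^(2n), and
    the interiors of the balls form one further cell of dimension 4k+3.  The
    boundary of that cell lies over the lower skeleton of HP^(n-1) or in the
    sphere bundle, hence in cells of smaller dimension, and the cells of
    dimension 3, 7, ..., 4n-1 can be attached one after the other ([stages]).

    Homotopy equivalence.  Contracting every ball to its center maps [X] to HP^n,
    and on the 4n-cell this map is injective.  In the other direction HP^(n-1)
    goes to the centers of the balls.  The inner half of the 4n-cell of HP^n is
    stretched over the 4n-cell of CP^(2n), and the outer half follows the radii
    of the balls from the sphere bundle to the centers ([zero_section]).  Stretching and pushing at variable speed ([flow],
    [collar]) gives the two homotopies.

    Both [X] and HP^n are handled through embeddings in spaces of quaternionic
    matrices.  The line of [w] is sent to the projector conj(w)^T w, and the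
    point [q] of the ball over it to the pair (conj(w)^T w, conj(w)^T q w), see
    [ball_point].  The spaces are compact and matrices form a Hausdorff space,
    so bijections become homeomorphisms ([compact_inverse]) and continuity can
    be checked after composition with a map from a disk
    ([compact_image_continuous]).  The adjunction spaces are recognized as
    subspaces of the matrices by [attach_step], and the axioms of a CW complex
    follow by [finite_CW]. *)

Set Implicit Arguments.
Unset Strict Implicit.
Unset Printing Implicit Defensive.
Import Order.TTheory GRing.Theory Num.Theory.
Import numFieldNormedType.Exports.
Local Open Scope classical_set_scope.
Local Open Scope ring_scope.
Local Open Scope quotient_scope.
Local Open Scope complex_scope.

(** * Compact and Hausdorff spaces *)

Section topology.
Implicit Types T U V : topologicalType.

Lemma injective_hausdorff T U (f : T -> U) :
  continuous f -> injective f -> hausdorff_space U -> hausdorff_space T.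
Proof.
move=> cf injf hU x y xy; apply: injf; apply: hU => A B nA nB.
have [z [Az Bz]] := xy _ _ (cf x _ nA) (cf y _ nB).
by exists (f z).
Qed.

Lemma comp_continuous T U V (g : U -> V) (f : T -> U) :
  continuous g -> continuous f -> continuous (fun x => g (f x)).
Proof. by move=> cg cf x; apply: continuous_comp; [exact: cf|exact: cg]. Qed.

Lemma prod_hausdorff T U :
  hausdorff_space T -> hausdorff_space U -> hausdorff_space (T * U)%type.
Proof.
move=> hT hU [x1 x2] [y1 y2] xy; congr (_, _).
  apply: hT => A B nA nB.
  have [] := xy (fst @^-1` A) (fst @^-1` B); [exact: cvg_fst|exact: cvg_fst|].
  by move=> z [Az Bz]; exists z.1.
apply: hU => A B nA nB.
have [] := xy (snd @^-1` A) (snd @^-1` B); [exact: cvg_snd|exact: cvg_snd|].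
by move=> z [Az Bz]; exists z.2.
Qed.

(** A continuous map from a compact set to a Hausdorff space is closed, hence
    a quotient map onto its image.  This gives continuity of maps out of
    projective spaces, and of homotopies on a product with an interval, where
    quotient maps are not preserved in general. *)
Lemma compact_image_continuous T U V (f : T -> U) (g : U -> V) (A : set T) :
  hausdorff_space U -> compact A -> {within A, continuous f} ->
  {within A, continuous (g \o f)} -> {within f @` A, continuous g}.
Proof.
move=> hU cA cf /continuous_closedP cgf; apply/continuous_closedP => C clC.
apply/closed_subspaceP.
have /closed_subspaceP[D clD DE] := cgf _ clC.
exists (f @` (A `&` D)).
  apply: compact_closed => //; apply: continuous_compact.
    by apply: continuous_subspaceW cf => x [].
  exact: compact_closedI.
rewrite eqEsubset; split=> y.
  move=> [[x [Ax Dx] <-] _]; split; last by exists x.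
  by have [] : ((g \o f) @^-1` C `&` A) x by rewrite -DE.
move=> [Cy [x Ax xy]]; split; last by exists x.
exists x => //; split => //.
by have [] : (D `&` A) x by rewrite DE; split => //; change (C (g (f x))); rewrite xy.
Qed.

(** Composed with [f] the inverse is the identity, so its continuity is a case
    of [compact_image_continuous]. *)
Lemma compact_inverse T U (f : T -> U) (x0 : T) :
  hausdorff_space U -> compact [set: T] -> continuous f -> injective f ->
  exists2 g : U -> T, cancel f g & {within range f, continuous g}.
Proof.
move=> hU cT cf injf.
have [g fK] : exists g : U -> T, cancel f g.
  exists (fun u => if pselect (exists x, f x = u) is left e then projT1 (cid e)
                   else x0) => x.
  case: pselect => [e|[]]; last by exists x.
  by case: cid => y /= /injf.
exists g => //; apply: compact_image_continuous => //.
  exact: continuous_subspaceT.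
apply: continuous_subspaceT => x; rewrite (_ : g \o f = id) //.
by apply/funext => y; exact: fK.
Qed.

Lemma compact_set_type T (A : set T) (x0 : A) :
  compact A -> compact [set: A].
Proof.
move=> cA.
have sE : sigL A (insubd x0) = id.
  by apply/funext => x; rewrite /sigL /= valKd.
have -> : [set: A] = insubd x0 @` A.
  rewrite eqEsubset; split=> // x _; exists (\val x); first exact: set_valP.
  by rewrite valKd.
apply: continuous_compact => //; apply/subspace_sigL_continuousP.
by rewrite sE => x.
Qed.

Lemma set_val_continuous T (A : set T) : continuous (\val : A -> T).
Proof. exact: initial_continuous. Qed.

Lemma matrix_continuous T U m n (f : T -> 'M[U]_(m, n)) :
  (forall i j, continuous (fun t => f t i j)) -> continuous f.
Proof.
move=> cf x A [P nP PA].
have : \forall y \near x, forall i, forall j, P i j (f y i j).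
  by apply: filter_forall => i; apply: filter_forall => j; exact: cf.
by rewrite nbhs_simpl /=; apply: filterS => y Py; exact: PA.
Qed.

Lemma entry_continuous U m n (i : 'I_m) (j : 'I_n) :
  continuous (fun M : 'M[U]_(m, n) => M i j).
Proof.
move=> M A nA.
exists (fun i' j' => if (i' == i) && (j' == j) then A else setT).
  by move=> i' j'; case: ifP => [/andP[/eqP-> /eqP->]//|_]; exact: filterT.
by move=> N /(_ i j); rewrite !eqxx.
Qed.

Lemma matrix_hausdorff U m n :
  hausdorff_space U -> hausdorff_space 'M[U]_(m, n).
Proof.
move=> hU M N MN; apply/matrixP => i j; apply: hU => A B nA nB.
have [L [AL BL]] := MN _ _ (entry_continuous nA) (entry_continuous nB).
by exists (L i j).
Qed.

(** Here [g] is continuous on the subspace [B], but perhaps at no point of [B]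
    as a map on the whole of [U]. *)
Lemma within_comp_continuous T U V (A : set T) (B : set U) (f : T -> U)
    (g : U -> V) :
  {within A, continuous f} -> (forall x, A x -> B (f x)) ->
  {within B, continuous g} -> {within A, continuous (g \o f)}.
Proof.
move=> /continuous_closedP cf fAB /continuous_closedP cg.
apply/continuous_closedP => C clC.
have /closed_subspaceP[D clD DE] := cg _ clC.
have /closed_subspaceP[E clE EE] := cf _ clD.
apply/closed_subspaceP; exists E => //; rewrite EE.
rewrite eqEsubset; split=> x [Cx Ax]; split => //.
  have [] // : (from_subspace B g @^-1` C `&` B) (f x).
  by rewrite -DE; split => //; exact: fAB.
have [] // : (D `&` B) (f x).
by rewrite DE; split => //; exact: fAB.
Qed.

Lemma comp_within_continuous T U V (B : set U) (f : T -> U) (g : U -> V) :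
  continuous f -> (forall x, B (f x)) -> {within B, continuous g} ->
  continuous (fun x => g (f x)).
Proof.
move=> cf fB cg; apply/continuous_subspace_setT.
apply: (@within_comp_continuous _ _ _ setT B f g) => //.
exact: continuous_subspaceT.
Qed.

Lemma set_type_continuous T U (A : set U) (f : T -> A) :
  continuous (fun x => \val (f x)) -> continuous f.
Proof.
move=> cf; apply/continuousP => _ [B oB <-].
by move/continuousP : cf => /(_ _ oB).
Qed.

Lemma fst_continuous (T U : topologicalType) : continuous (@fst T U).
Proof. by move=> x; exact: cvg_fst. Qed.

Lemma snd_continuous (T U : topologicalType) : continuous (@snd T U).
Proof. by move=> x; exact: cvg_snd. Qed.

Lemma pair_continuous (T U V : topologicalType) (f : T -> U) (g : T -> V) :
  continuous f -> continuous g -> continuous (fun x => (f x, g x)).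
Proof.
move=> cf cg x.
exact: (@cvg_pair _ _ _ (nbhs x) (nbhs (f x)) (nbhs (g x)) _ _ _ f g (cf x) (cg x)).
Qed.

Lemma eq_in_within_continuous (T U : topologicalType) (A : set T) (f g : T -> U) :
  (forall x, A x -> g x = f x) -> continuous f -> {within A, continuous g}.
Proof.
move=> fg cf; apply: (@subspace_eq_continuous _ _ _ f).
  by move=> x /set_mem Ax; change (f x = g x); rewrite fg.
exact: continuous_subspaceT.
Qed.

End topology.

Section disks.
Context {R : realType}.

Lemma sum_continuous (T : topologicalType) (I : Type) (r : seq I) (P : pred I)
    (F : I -> T -> R) :
  (forall i, continuous (F i)) ->
  continuous (fun x => \sum_(i <- r | P i) F i x).
Proof.
move=> cF; elim: r => [|i r IHr].
  rewrite (_ : (fun y => _) = fun=> 0); first exact: cst_continuous.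
  by apply/funext => y; rewrite big_nil.
rewrite (_ : (fun y => _) = if P i
    then fun y => F i y + \sum_(j <- r | P j) F j y
    else fun y => \sum_(j <- r | P j) F j y); last first.
  by apply/funext => y; rewrite big_cons; case: (P i).
by case: (P i) => // x; apply: cvgD; [exact: cF|exact: IHr].
Qed.

Lemma sqnorm_continuous p : continuous (@sqnorm R p).
Proof.
apply: sum_continuous => i; apply: (comp_continuous (@exprn_continuous R 2)).
exact: entry_continuous.
Qed.

Lemma sqr_le_sqnorm p (x : 'rV[R]_p) i : x 0 i ^+ 2 <= sqnorm x.
Proof.
rewrite /sqnorm (bigD1 i) //= lerDl.
by apply: sumr_ge0 => j _; exact: sqr_ge0.
Qed.

Lemma disk_compact p : compact (disk R p).
Proof.
apply: subclosed_compact (rV_compact (fun=> @segment_compact R (-1) 1)) _.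
  apply: (@closed_comp _ _ _ [set y : R | y <= 1]); last exact: closed_le.
  by move=> x _; exact: sqnorm_continuous.
move=> x x1 i /=; rewrite in_itv /= -ler_norml.
rewrite -(@ler_pXn2r _ 2) ?nnegrE // expr1n real_normK ?num_real //.
exact: le_trans (sqr_le_sqnorm x i) x1.
Qed.

Lemma disk_center p : disk R p 0.
Proof. by rewrite /disk /= /sqnorm big1 // => i _; rewrite mxE expr0n. Qed.

Lemma diskT_compact p : compact [set: disk R p].
Proof.
apply: (compact_set_type _ (@disk_compact p)).
exact: (exist _ 0 (mem_set (disk_center p))).
Qed.

End disks.

(** * Finite CW complexes *)

Section cells.
Context {R : realType}.
Implicit Types X A : cell_space R.

Lemma disk_interior_or_boundary p (x : disk R p) :
  disk_interior x \/ disk_boundary x.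
Proof.
have := set_valP x; rewrite /disk /= le_eqVlt => /orP[/eqP|]; first by right.
by left.
Qed.

Lemma disk_interior_open p : open (@disk_interior R p).
Proof.
apply: (@open_comp _ _ (fun x : disk R p => sqnorm (\val x)) [set y | y < 1]).
  move=> x _; apply: continuous_comp; first exact: set_val_continuous.
  exact: sqnorm_continuous.
exact: open_lt.
Qed.

(** The images on the right are compact when the preimages of [C] are closed,
    so that both compactness of [X] ([C := setT]) and the weak topology come
    from this equality. *)
Lemma closed_cells_cover X (C : set X) :
  (forall x, exists! e, @open_cell R X e x) ->
  C = \bigcup_(e in [set: cell X])
        (@char_map R X e @` (@char_map R X e @^-1` C)).
Proof.
move=> part; rewrite eqEsubset; split=> [x Cx|_ [e _] [y Cy <-]//].
have [e [[y _ yx] _]] := part x.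
by exists e => //; exists y => //=; rewrite yx.
Qed.

Lemma finite_bigcup_compact (T : topologicalType) (I : Type) (F : I -> set T) :
  finite_set [set: I] -> (forall i, compact (F i)) ->
  compact (\bigcup_(i in [set: I]) F i).
Proof.
move=> finI cF; rewrite -(@bigsetU_fset_set _ {classic I} [set: I] F finI).
by elim/big_rec: _ => [|i A _]; [exact: compact0|exact: compactU].
Qed.

Lemma finite_cells_compact X :
  finite_set [set: cell X] ->
  (forall e, continuous (@char_map R X e)) ->
  (forall x, exists! e, @open_cell R X e x) -> compact [set: X].
Proof.
move=> finX cX part; rewrite (closed_cells_cover setT part).
apply: finite_bigcup_compact => // e; rewrite preimage_setT.
apply: continuous_compact; last exact: diskT_compact.
by apply: continuous_subspaceT; exact: cX.
Qed.

(** With finitely many cells the topological axioms are consequences of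
    compactness: the characteristic maps are closed, so they embed the open
    disks, and a set with closed preimages is a finite union of compact
    images. *)
Lemma finite_CW X :
  finite_set [set: cell X] -> hausdorff_space X ->
  (forall e, continuous (@char_map R X e)) ->
  (forall e, {in @disk_interior R (dim e) &, injective (@char_map R X e)}) ->
  (forall x, exists! e, @open_cell R X e x) ->
  (forall e x, @disk_boundary R (dim e) x ->
     exists2 e' : cell X, (dim e' < dim e)%N & open_cell e' (char_map x)) ->
  is_CW X.
Proof.
move=> finX hX cX injX part bdX.
have imC' e (D : set (disk R (dim e))) : closed D -> compact (@char_map R X e @` D).
  move=> clD; apply: continuous_compact; first by apply: continuous_subspaceT; exact: cX.
  have cT := @diskT_compact R (dim e).
  exact: (subclosed_compact clD cT).
have imC e (D : set (disk R (dim e))) : closed D -> closed (@char_map R X e @` D).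
  by move=> /imC'; exact: compact_closed.
split => //.
- move=> e; split; first by apply: continuous_subspaceT; exact: cX.
    exact: injX.
  move=> V oV; exists (~` (@char_map R X e @` ~` (@disk_interior R (dim e) `&` V))).
    rewrite openC; apply: imC; rewrite closedC.
    by apply: openI => //; exact: disk_interior_open.
  rewrite eqEsubset; split=> [_ [x [ix Vx] <-]|_ [[x ix <-]] nVx].
    split; [by exists x|move=> [y nVy yx]; apply: nVy].
    have [iy|by_] := disk_interior_or_boundary y.
      by rewrite (injX e y x (mem_set iy) (mem_set ix) yx).
    have [e' lt_e' e'y] := bdX _ _ by_.
    have [f [_ fE]] := part (char_map y).
    have ef : f = e by apply: fE; rewrite yx; exists x.
    by have := fE _ e'y; rewrite ef => ee'; rewrite ee' ltnn in lt_e'.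
  exists x => //; split => //; apply: contrapT => nV.
  by apply: nVx; exists x => // -[].
- move=> e; exists [set e' | (dim e' < dim e)%N]; split => //.
    exact: sub_finite_set finX.
  by move=> _ [x bx <-]; have [e' ? ?] := bdX _ _ bx; exists e'.
- move=> C clC; rewrite (closed_cells_cover C part).
  apply: compact_closed => //; apply: finite_bigcup_compact => // e.
  by apply: imC'; exact: clC.
Qed.

End cells.

(** * Attaching a cell inside a Hausdorff space *)

Section attaching.
Context {R : realType} (M : topologicalType).
Implicit Types A X : cell_space R.

(** A finite complex drawn inside [M]; by compactness [iota] is an embedding
    when [M] is Hausdorff. *)
Definition realised X (iota : X -> M) :=
  [/\ is_CW X, finite_set [set: cell X], continuous iota & injective iota].

(** The skeleton of dimension [p - 1], that is, the part of the complex to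
    which the boundary of a [p]-cell must be attached. *)
Definition skeleton X (iota : X -> M) (p : nat) : set M :=
  [set m | exists2 e : cell X, (dim e < p)%N & (iota @` open_cell e) m].

Lemma realised_compact X (iota : X -> M) : realised iota -> compact [set: X].
Proof.
move=> [cwX finX _ _]; apply: finite_cells_compact => //.
  exact: CW_continuous.
exact: CW_partition.
Qed.

Section step.
Variables (A : cell_space R) (iota : A -> M) (p : nat) (Phi : disk R p -> M).
Hypothesis hM : hausdorff_space M.
Hypothesis rA : realised iota.
Hypothesis cPhi : continuous Phi.
Hypothesis iPhi : {in @disk_interior R p &, injective Phi}.
Hypothesis nPhi : forall x, disk_interior x -> ~ range iota (Phi x).
Hypothesis bPhi : forall x, disk_boundary x -> skeleton iota p (Phi x).

Variable phi : sphere R p -> A.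
Hypothesis phiE :
  forall s (x : disk R p), \val s = \val x -> iota (phi s) = Phi x.

Let val_sum (u : attach_sum A p) : M :=
  let: existT b y := u in
  match b return attach_summand A p b -> M with
  | true => iota
  | false => Phi
  end y.

Let val_sum_continuous : continuous val_sum.
Proof.
have [_ _ ci _] := rA.
by move=> [[] x] U nU; [exact: (ci x U nU)|exact: (cPhi nU)].
Qed.

(** Each class of the adjunction space has one representative that is either
    a point of [A] or an interior point of the disk. *)
Let collapse_cases u :
  (exists2 a, attach_collapse phi u = attach_inl p a & val_sum u = iota a) \/
  (exists x : disk R p, [/\ disk_interior x, attach_collapse phi u = attach_inr A x
     & val_sum u = Phi x]).
Proof.
case: u => [[] /= x]; first by left; exists x.
case: insubP => [s xS sx|xS]; [left; exists (phi s)|right; exists x] => //.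
  exact/esym/phiE.
split => //; have [//|bx] := disk_interior_or_boundary x.
by rewrite (mem_set (bx : sphere R p (\val x))) in xS.
Qed.

(** The gluing relation is the kernel of the map to [M]: interior points of
    the disk land outside the image of [A], and injectively. *)
Let collapse_eqP u v :
  attach_collapse phi u = attach_collapse phi v <-> val_sum u = val_sum v.
Proof.
have [_ _ _ ii] := rA.
have inlI : injective (@attach_inl _ A p).
  by move=> a b /eqP; rewrite eq_Tagged /= => /eqP.
have inrI : injective (@attach_inr _ A p).
  by move=> a b /eqP; rewrite eq_Tagged /= => /eqP.
have [[a -> ->]|[x [ix -> ->]]] := collapse_cases u;
  have [[b -> ->]|[y [iy -> ->]]] := collapse_cases v.
- by split=> [/inlI->//|/ii->].
- split=> [//|ay]; by case: (nPhi iy); exists a.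
- split=> [//|xb]; by case: (nPhi ix); exists b.
- by split=> [/inrI->//|/iPhi xy]; rewrite xy ?inE.
Qed.

(** The realisation of the adjunction space in [M]. *)
Definition attach_val : attach_cell phi -> M :=
  (val_sum \o repr : adjunction phi -> M).

Let attach_valE u : attach_val (adjunction_pi phi u) = val_sum u.
Proof.
apply/collapse_eqP; apply/eqP.
suff /eqmodP uE : repr (adjunction_pi phi u) = u %[mod {eq_quot attach_equiv phi}].
  exact: uE.
exact: (reprK (adjunction_pi phi u)).
Qed.

Let attach_val_continuous : continuous attach_val.
Proof.
apply: repr_comp_continuous => // u v /eqP/eqmodP/eqP uv.
exact/eqP/collapse_eqP.
Qed.

Let adjunction_piP (x : adjunction phi) : exists u, x = adjunction_pi phi u.
Proof. by exists (repr x); rewrite /adjunction_pi reprK. Qed.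

Let attach_val_inj : injective attach_val.
Proof.
move=> x y; have [u ->] := adjunction_piP x; have [v ->] := adjunction_piP y.
rewrite !attach_valE => /collapse_eqP uv; apply/eqmodP; exact/eqP.
Qed.

Let attach_val_inl a : attach_val (adjunction_pi phi (attach_inl p a)) = iota a.
Proof. exact: attach_valE. Qed.

Let attach_val_inr x : attach_val (adjunction_pi phi (attach_inr A x)) = Phi x.
Proof. exact: attach_valE. Qed.

Let adjunction_cases (y : adjunction phi) :
  (exists a, y = adjunction_pi phi (attach_inl p a)) \/
  (exists2 x, disk_interior x & y = adjunction_pi phi (attach_inr A x)).
Proof.
have [u ->] := adjunction_piP y.
have [[a _ uE]|[x [ix _ uE]]] := collapse_cases u; [left; exists a|right; exists x] => //;
  apply: attach_val_inj; rewrite attach_valE uE.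
- by rewrite attach_val_inl.
- by rewrite attach_val_inr.
Qed.

Let pi_continuous : continuous (adjunction_pi phi).
Proof. exact: pi_continuous. Qed.

Lemma attach_cell_CW : is_CW (attach_cell phi).
Proof.
have [cwA finA ci ii] := rA.
apply: finite_CW.
- rewrite (_ : [set: cell (attach_cell phi)] = Some @` [set: cell A] `|` [set None]).
    by rewrite finite_setU; split; [exact: finite_image|exact: finite_set1].
  rewrite eqEsubset; split=> -[e|] // _; [by left; exists e|by right].
- exact: injective_hausdorff attach_val_continuous attach_val_inj hM.
- move=> [e|] /=.
    apply: (comp_continuous pi_continuous); apply: comp_continuous.
      exact: (@existT_continuous _ (attach_summand A p) true).
    exact: CW_continuous.
  apply: (comp_continuous pi_continuous).
  exact: (@existT_continuous _ (attach_summand A p) false).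
- move=> [e|] x y ix iy /(congr1 attach_val) /=.
    rewrite !attach_val_inl => /ii.
    by have [_ inj _] := CW_homeo cwA e; exact: inj.
  by rewrite !attach_val_inr; exact: iPhi.
- move=> y; have [[a ->]|[x ix ->]] := adjunction_cases y.
    have [e [[x ix xa] eU]] := CW_partition cwA a.
    exists (Some e); split; first by exists x => //=; rewrite xa.
    move=> [e'|] [z iz /(congr1 attach_val)]; rewrite /= attach_val_inl.
      by rewrite attach_val_inl => /ii za; rewrite (eU e') //; exists z.
    by rewrite attach_val_inr => za; case: (nPhi iz); exists a.
  exists None; split; first by exists x.
  move=> [e'|//] [z iz /(congr1 attach_val)]; rewrite /= attach_val_inl attach_val_inr => zx.
  by case: (nPhi ix); rewrite -zx; exact: imageT.
- move=> [e|] x bx /=.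
    have [J [_ dimJ bJ]] := CW_closure_finite cwA e.
    have [e' Je' [y iy yx]] := bJ _ (ex_intro2 _ _ x bx erefl).
    by exists (Some e'); [exact: dimJ|exists y => //=; rewrite yx].
  have [e' de' [a [y iy ya] ax]] := bPhi bx.
  exists (Some e') => //; exists y => //=.
  by apply: attach_val_inj; rewrite attach_val_inl attach_val_inr ya.
Qed.

Lemma attach_val_realised : realised attach_val.
Proof.
have [cwA finA ci ii] := rA.
split; [exact: attach_cell_CW| |exact: attach_val_continuous|exact: attach_val_inj].
rewrite (_ : [set: cell (attach_cell phi)] = Some @` [set: cell A] `|` [set None]).
  by rewrite finite_setU; split; [exact: finite_image|exact: finite_set1].
by rewrite eqEsubset; split=> -[e|] // _; [left; exists e|right].
Qed.

Lemma range_attach_val : range attach_val = range iota `|` range Phi.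
Proof.
rewrite eqEsubset; split=> [_ [y _ <-]|m [[a _ <-]|[x _ <-]]].
- have [[a ->]|[x ix ->]] := adjunction_cases y.
    by left; exists a => //; rewrite attach_val_inl.
  by right; exists x => //; rewrite attach_val_inr.
- by exists (adjunction_pi phi (attach_inl p a)) => //; rewrite attach_val_inl.
- by exists (adjunction_pi phi (attach_inr A x)) => //; rewrite attach_val_inr.
Qed.

Lemma skeleton_attach_val q : skeleton iota q `<=` skeleton attach_val q.
Proof.
move=> _ [e de [_ [x ix <-] <-]]; exists (Some e) => //.
exists (adjunction_pi phi (attach_inl p (char_map x))); last exact: attach_val_inl.
by exists x.
Qed.

Lemma skeleton_attach_val_new q x :
  (p < q)%N -> disk_interior x -> skeleton attach_val q (Phi x).
Proof.
move=> pq ix; exists None => //.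
exists (adjunction_pi phi (attach_inr A x)); last exact: attach_val_inr.
by exists x.
Qed.

End step.

(** The attaching map is the restriction of [Phi] to the sphere, pulled back
    along the embedding [iota].  As the adjunction space still injects into
    [M], all its properties can be read there, and the step can be iterated. *)
Lemma attach_step A (iota : A -> M) p (Phi : disk R p -> M) (a0 : A) :
  hausdorff_space M -> realised iota -> continuous Phi ->
  {in @disk_interior R p &, injective Phi} ->
  (forall x, disk_interior x -> ~ range iota (Phi x)) ->
  (forall x, disk_boundary x -> skeleton iota p (Phi x)) ->
  exists2 phi : sphere R p -> A, continuous phi &
  exists iota' : attach_cell phi -> M,
    [/\ realised iota', range iota' = range iota `|` range Phi,
        forall q, skeleton iota q `<=` skeleton iota' q &
        forall q x, (p < q)%N -> disk_interior x -> skeleton iota' q (Phi x)].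
Proof.
move=> hM rA cPhi iPhi nPhi bPhi; have [_ _ ci ii] := rA.
have [j iK cj] := compact_inverse a0 hM (realised_compact rA) ci ii.
have sphere_disk (s : sphere R p) : \val s \in disk R p.
  by have := set_valP s; rewrite inE /sphere /disk /= => ->.
pose incl (s : sphere R p) : disk R p := exist _ (\val s) (sphere_disk s).
have incl_range s : range iota (Phi (incl s)).
  have bs : disk_boundary (incl s) by exact: (set_valP s).
  by have [e _ [a _ <-]] := bPhi _ bs; exists a.
exists (fun s => j (Phi (incl s))).
  apply: (comp_within_continuous _ incl_range cj).
  apply: (comp_continuous cPhi); apply: set_type_continuous.
  exact: set_val_continuous.
have phiE (s : sphere R p) (x : disk R p) : \val s = \val x ->
    iota (j (Phi (incl s))) = Phi x.
  move=> sx; have -> : x = incl s by exact/val_inj.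
  by have [a _ <-] := incl_range s; rewrite iK.
exists (@attach_val A iota p Phi (fun s => j (Phi (incl s)))); split.
- exact: attach_val_realised.
- exact: range_attach_val.
- exact: skeleton_attach_val.
- exact: skeleton_attach_val_new.
Qed.

End attaching.

(** * Quaternions *)

Section quaternion_theory.
Context {R : realType}.
Implicit Types (p q r u : quat R) (x y t : R).

Definition qconj q : quat R := (conjc q.1, - q.2).
Definition qreal x : quat R := (x%:C, 0).
Definition qsq q : R :=
  complex.Re q.1 ^+ 2 + complex.Im q.1 ^+ 2 + (complex.Re q.2 ^+ 2 + complex.Im q.2 ^+ 2).
Definition qi : quat R := (0 +i* 1, 0).

Ltac qring :=
  apply: quatP; apply/eqP; rewrite eq_complex /=; apply/andP; split; apply/eqP; ring.

Lemma qconjM p q : qconj (p * q) = qconj q * qconj p.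
Proof. by case: p q => [[? ?] [? ?]] [[? ?] [? ?]]; qring. Qed.

Lemma qconj_real x : qconj (qreal x) = qreal x.
Proof. by qring. Qed.

Lemma qmul_conj q : q * qconj q = qreal (qsq q).
Proof. by case: q => [[? ?] [? ?]]; rewrite /qsq; qring. Qed.

Lemma qconj_mul q : qconj q * q = qreal (qsq q).
Proof. by case: q => [[? ?] [? ?]]; rewrite /qsq; qring. Qed.

Lemma qreal_comm x q : qreal x * q = q * qreal x.
Proof. by case: q => [[? ?] [? ?]]; qring. Qed.

Lemma qrealM x y : qreal (x * y) = qreal x * qreal y.
Proof. by qring. Qed.

Lemma qrealD x y : qreal (x + y) = qreal x + qreal y.
Proof. by qring. Qed.

Lemma qreal0 : qreal 0 = 0. Proof. by []. Qed.
Lemma qreal1 : qreal 1 = 1. Proof. by []. Qed.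

Lemma qreal_inj : injective qreal.
Proof. by move=> x y []. Qed.

Lemma qsqM p q : qsq (p * q) = qsq p * qsq q.
Proof. by case: p q => [[? ?] [? ?]] [[? ?] [? ?]]; rewrite /qsq /=; ring. Qed.

Lemma qsq_conj q : qsq (qconj q) = qsq q.
Proof. by case: q => [[? ?] [? ?]]; rewrite /qsq /=; ring. Qed.

Lemma qsq_real x : qsq (qreal x) = x ^+ 2.
Proof. by rewrite /qsq /=; ring. Qed.

Lemma qsq_i : qsq qi = 1.
Proof. by rewrite /qsq /=; ring. Qed.

Lemma qsq1 : qsq 1 = 1.
Proof. by rewrite /qsq /=; ring. Qed.

Lemma qsq0 : qsq 0 = 0.
Proof. by rewrite /qsq /=; ring. Qed.

Lemma qsq_ge0 q : 0 <= qsq q.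
Proof. by rewrite /qsq !addr_ge0 // sqr_ge0. Qed.

Lemma qsq_eq0 q : (qsq q == 0) = (q == 0).
Proof.
case: q => [[a b] [c d]]; have sq0 := @sqr_ge0 R; rewrite /qsq /=.
rewrite paddr_eq0 ?addr_ge0// !paddr_eq0// !sqrf_eq0 xpair_eqE.
by rewrite !eq_complex.
Qed.

Lemma qsq_gt0 q : (0 < qsq q) = (q != 0).
Proof. by rewrite lt_def qsq_ge0 andbT qsq_eq0. Qed.

Lemma qunitE q : (q \is a GRing.unit) = (q != 0).
Proof. by []. Qed.

(** The centralizer of i consists of the complex numbers; this is why the
    imaginary quaternion conj(u) i u remembers the complex line of [u w]. *)
Lemma qcomm_i q : q * qi = qi * q <-> q.2 = 0.
Proof.
case: q => [[a b] [c d]]; split => /=.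
  move=> [_ _]; rewrite ?(mulr0, mul0r, mulr1, mul1r, addr0, add0r, subr0, sub0r).
  move=> *; apply/eqP; rewrite eq_complex /=; apply/andP; split; apply/eqP; lra.
by move=> [-> ->]; qring.
Qed.

(** The fiber over a quaternionic line is the unit ball of the imaginary
    quaternions, a space of real dimension 3. *)
Definition imaginary q := complex.Re q.1 = 0.

Lemma imaginary_conj q : imaginary q -> qconj q = - q.
Proof.
rewrite /imaginary; case: q => [[a b] c] /= ->; apply: quatP => //=.
by apply/eqP; rewrite eq_complex /= oppr0 !eqxx.
Qed.

Lemma imaginary_rotation q u : imaginary q -> imaginary (qconj u * q * u).
Proof.
rewrite /imaginary; case: q u => [[a b] [c d]] [[e f] [g h]] /= ->; ring.
Qed.

Lemma imaginary_real q x : imaginary q -> imaginary (qreal x * q).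
Proof. by rewrite /imaginary; case: q => [[a b] [c d]] /= ->; ring. Qed.

Lemma imaginary_i : imaginary qi.
Proof. by []. Qed.

(** The equation q = conj(u) i u means i u = u q for a unit u.  Since q q = -1,
    it is solved by 1 - i q, up to the norm.  This vanishes only for q = -i,
    and then u = j is a solution. *)
Lemma unit_imaginary_rotation q : imaginary q -> qsq q = 1 ->
  exists2 u, qsq u = 1 & q = qconj u * qi * u.
Proof.
move=> imq q1; pose v := 1 - qi * q.
have qq : q * q = - 1.
  by rewrite -qreal1 -q1 -qmul_conj imaginary_conj // mulrN opprK.
have qiqi : qi * qi = -1 :> quat R by qring.
(* Hence conj(v) i v = |v|^2 q, and only the norm of [v] has to be corrected. *)
have vE : qi * v = v * q.
  by rewrite /v mulrBr mulrBl mulr1 mul1r mulrA qiqi -mulrA qq mulrN1 mulN1r !opprK addrC.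
have [v0|v0] := eqVneq v 0.
  exists (0, 1); first by rewrite /qsq /=; ring.
  have -> : q = - qi.
    have : qi * v = 0 by rewrite v0 mulr0.
    rewrite /v mulrBr mulr1 mulrA qiqi mulN1r opprK => /eqP.
    by rewrite addrC addr_eq0 => /eqP.
  by qring.
pose c := (Num.sqrt (qsq v))^-1.
have c2 : c * c * qsq v = 1.
  by rewrite -invfM -expr2 sqr_sqrtr ?qsq_ge0 // mulVf // qsq_eq0.
exists (qreal c * v); first by rewrite qsqM qsq_real expr2.
rewrite qconjM qconj_real -!mulrA [qi * _]mulrA -[qi * qreal c]qreal_comm.
rewrite -[_ * qi * v]mulrA vE [qreal c * (qreal c * _)]mulrA -qrealM.
rewrite [qconj v * _]mulrA -[qconj v * _]qreal_comm -mulrA [qconj v * _]mulrA.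
by rewrite qconj_mul mulrA -qrealM c2 qreal1 mul1r.
Qed.

Lemma qreal_mulI (c : R) q q' :
  c != 0 -> qreal c * q = qreal c * q' -> q = q'.
Proof.
by move=> c0; apply: mulrI; rewrite qunitE -qsq_eq0 qsq_real expf_eq0.
Qed.

Lemma quat_hausdorff : hausdorff_space (quat R).
Proof. by apply: prod_hausdorff; exact: norm_hausdorff. Qed.

End quaternion_theory.

(** * Continuity of quaternionic expressions *)

Section continuity.
Context {R : realType}.

(** The norm of [R[i]] has its values in [R[i]], so the radii of balls have
    to be converted between [R] and [R[i]]. *)
Lemma Re_continuous : continuous (fun z : cplx R => complex.Re z : R).
Proof.
move=> z A /nbhs_ballP[e /= e0 eA]; apply/nbhs_ballP.
exists e%:C; first by rewrite /= ltcR.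
move=> w; rewrite -ball_normE /= => zw; apply: eA; rewrite -ball_normE /=.
rewrite -ltcR; apply: le_lt_trans zw.
by have := normc_ge_Re (z - w); rewrite raddfB.
Qed.

Lemma real_complex_continuous : continuous (fun x : R => x%:C : cplx R).
Proof.
move=> x A /nbhs_ballP[e /= e0 eA]; apply/nbhs_ballP.
have eE : e = (complex.Re e)%:C.
  by apply/eqP; rewrite eq_complex /= eqxx (ger0_Im (ltW e0)) eqxx.
exists (complex.Re e); first by move: e0; rewrite eE /= ltcR.
move=> y; rewrite -ball_normE /= => xy; apply: eA; rewrite -ball_normE /=.
rewrite eE -[X in `|X|](rmorphB (@real_complex R)) normc_def /= ltcR.
by rewrite expr0n addr0 sqrtr_sqr.
Qed.

End continuity.

Section continuity.
Context {R : realType} {T : topologicalType}.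

Lemma mulc_continuous (f g : T -> cplx R) :
  continuous f -> continuous g -> continuous (fun x => f x * g x : cplx R).
Proof. by move=> cf cg x; apply: cvgM; [exact: cf|exact: cg]. Qed.

Lemma addc_continuous (f g : T -> cplx R) :
  continuous f -> continuous g -> continuous (fun x => f x + g x : cplx R).
Proof. by move=> cf cg x; apply: cvgD; [exact: cf|exact: cg]. Qed.

Lemma oppc_continuous (f : T -> cplx R) :
  continuous f -> continuous (fun x => - f x : cplx R).
Proof. by move=> cf x; apply: cvgN; exact: cf. Qed.

Lemma complex_continuous (f g : T -> R) :
  continuous f -> continuous g -> continuous (fun x => f x +i* g x : cplx R).
Proof.
move=> cf cg.
have -> : (fun x => f x +i* g x : cplx R) =
    (fun x => (f x)%:C + (0 +i* 1) * (g x)%:C : cplx R).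
  apply/funext => x; apply/eqP; rewrite eq_complex /=.
  by apply/andP; split; apply/eqP; ring.
apply: addc_continuous; first exact: comp_continuous real_complex_continuous cf.
apply: mulc_continuous; first exact: cst_continuous.
exact: comp_continuous real_complex_continuous cg.
Qed.

End continuity.

Lemma Im_continuous {R : realType} : continuous (fun z : cplx R => complex.Im z : R).
Proof.
have -> : (fun z : cplx R => complex.Im z : R) =
    (fun z : cplx R => complex.Re ((0 -i* 1) * z : cplx R)).
  by apply/funext => -[a b] /=; ring.
apply: (comp_continuous Re_continuous).
by apply: mulc_continuous; [exact: cst_continuous|move=> z].
Qed.

Section continuity.
Context {R : realType} {T : topologicalType}.

Lemma conjc_continuous (f : T -> cplx R) :
  continuous f -> continuous (fun x => conjc (f x) : cplx R).
Proof.
move=> cf.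
have -> : (fun x => conjc (f x) : cplx R) =
    (fun x => complex.Re (f x) +i* - complex.Im (f x) : cplx R).
  by apply/funext => x; case: (f x).
apply: complex_continuous; first exact: comp_continuous Re_continuous cf.
move=> x; apply: cvgN; exact: (comp_continuous Im_continuous cf).
Qed.

Lemma quat_continuous (f g : T -> cplx R) :
  continuous f -> continuous g -> continuous (fun x => (f x, g x) : quat R).
Proof.
move=> cf cg x.
exact: (@cvg_pair _ _ _ (nbhs x) (nbhs (f x)) (nbhs (g x)) _ _ _ f g (cf x) (cg x)).
Qed.

Lemma qfst_continuous (f : T -> quat R) :
  continuous f -> continuous (fun x => (f x).1 : cplx R).
Proof.
apply: (@comp_continuous _ _ _ (fun q : quat R => q.1 : cplx R)) => x.
exact: (@cvg_fst (cplx R) (cplx R)).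
Qed.

Lemma qsnd_continuous (f : T -> quat R) :
  continuous f -> continuous (fun x => (f x).2 : cplx R).
Proof.
apply: (@comp_continuous _ _ _ (fun q : quat R => q.2 : cplx R)) => x.
exact: (@cvg_snd (cplx R) (cplx R)).
Qed.

Lemma qmul_continuous (f g : T -> quat R) :
  continuous f -> continuous g -> continuous (fun x => f x * g x : quat R).
Proof.
move=> cf cg; apply: quat_continuous.
  apply: addc_continuous.
    by apply: mulc_continuous; exact: qfst_continuous.
  apply: oppc_continuous; apply: mulc_continuous; first exact: qsnd_continuous.
  by apply: conjc_continuous; exact: qsnd_continuous.
apply: addc_continuous; first apply: mulc_continuous.
- exact: qfst_continuous.
- exact: qsnd_continuous.
- apply: mulc_continuous; first exact: qsnd_continuous.
  by apply: conjc_continuous; exact: qfst_continuous.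
Qed.

Lemma qconj_continuous (f : T -> quat R) :
  continuous f -> continuous (fun x => qconj (f x)).
Proof.
move=> cf; apply: quat_continuous.
  by apply: conjc_continuous; exact: qfst_continuous.
by apply: oppc_continuous; exact: qsnd_continuous.
Qed.

Lemma qreal_continuous (f : T -> R) :
  continuous f -> continuous (fun x => qreal (f x)).
Proof.
move=> cf; apply: quat_continuous; last exact: cst_continuous.
exact: comp_continuous real_complex_continuous cf.
Qed.

Lemma addr_continuous (f g : T -> R) :
  continuous f -> continuous g -> continuous (fun x => f x + g x).
Proof. by move=> cf cg x; apply: cvgD; [exact: cf|exact: cg]. Qed.

Lemma oppr_continuous (f : T -> R) :
  continuous f -> continuous (fun x => - f x).
Proof. by move=> cf x; apply: cvgN; exact: cf. Qed.

Lemma mulr_continuous (f g : T -> R) :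
  continuous f -> continuous g -> continuous (fun x => f x * g x).
Proof. by move=> cf cg x; apply: cvgM; [exact: cf|exact: cg]. Qed.

Lemma invr_continuous (f : T -> R) :
  continuous f -> (forall x, f x != 0) -> continuous (fun x => (f x)^-1).
Proof. by move=> cf f0 x; apply: cvgV; [exact: f0|exact: cf]. Qed.

Lemma exprr_continuous (f : T -> R) k :
  continuous f -> continuous (fun x => f x ^+ k).
Proof. exact: (comp_continuous (@exprn_continuous R k)). Qed.

Lemma sqrtr_continuous (f : T -> R) :
  continuous f -> continuous (fun x => Num.sqrt (f x)).
Proof. exact: (comp_continuous (@sqrt_continuous R)). Qed.

Lemma maxr_continuous (f g : T -> R) :
  continuous f -> continuous g -> continuous (fun x => Num.max (f x) (g x)).
Proof.
move=> cf cg x.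
exact: (@continuous_max _ _ f g x (cf x) (cg x)).
Qed.

Lemma qsq_continuous (f : T -> quat R) :
  continuous f -> continuous (fun x => qsq (f x)).
Proof.
move=> cf; rewrite /qsq.
have cRe (g : T -> cplx R) : continuous g -> continuous (fun x => complex.Re (g x) : R).
  exact: comp_continuous Re_continuous.
have cIm (g : T -> cplx R) : continuous g -> continuous (fun x => complex.Im (g x) : R).
  exact: comp_continuous Im_continuous.
by do 2![apply: addr_continuous]; apply: exprr_continuous;
  (apply: cRe || apply: cIm); (exact: qfst_continuous || exact: qsnd_continuous).
Qed.

End continuity.

(** * Rows of quaternions and projectors *)

Lemma last_nonzero (V : nmodType) m (w : 'rV[V]_m) : w != 0 ->
  exists2 k : 'I_m, w 0 k != 0 & forall b : 'I_m, (k < b)%N -> w 0 b = 0.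
Proof.
move=> w0.
have /existsP[k0 k0P] : [exists k, w 0 k != 0].
  rewrite -negb_forall; apply: contra w0 => /forallP w0.
  by apply/eqP/rowP => k; rewrite mxE; exact/eqP.
have [k kP kmax] :=
  @arg_maxnP _ k0 (fun i => w 0 i != 0) (fun i : 'I_m => i : nat) k0P.
exists k => // b kb; apply/eqP; apply: contraTT kb => /kmax.
by rewrite -leqNgt.
Qed.

Section lines.
Context {R : realType}.
Implicit Types (q u : quat R) (t : R).

Definition nsq m (w : 'rV[quat R]_m) : R := \sum_a qsq (w 0 a).

(** The matrix conj(w)^T q w.  For q = 1 and a unit row w this is the
    projector onto the quaternionic line of w. *)
Definition sandwich m q (w : 'rV[quat R]_m) : 'M[quat R]_m :=
  \matrix_(a, b) (qconj (w 0 a) * q * w 0 b).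

(** The row (v_0, ..., v_(k-1), t, 0, ..., 0).  With t > 0 and norm 1, such
    rows represent each line of the open 4k-cell of quaternionic projective
    space exactly once. *)
Definition lvec m (k : nat) (v : nat -> quat R) t : 'rV[quat R]_m :=
  \row_b (if (b < k)%N then v b else if b == k :> nat then qreal t else 0).

Section dim.
Context {m : nat}.
Implicit Types w : 'rV[quat R]_m.

Lemma nsq_ge0 w : 0 <= nsq w.
Proof. by apply: sumr_ge0 => a _; exact: qsq_ge0. Qed.

Lemma nsq_eq0 w : (nsq w == 0) = (w == 0).
Proof.
rewrite psumr_eq0 => [|a _]; last exact: qsq_ge0.
apply/allP/eqP => [w0|-> a _]; last by rewrite mxE qsq0 eqxx.
apply/rowP => a; rewrite mxE; apply/eqP.
by rewrite -qsq_eq0; have := w0 a (mem_index_enum _).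
Qed.

Lemma nsq_scale u w : nsq (u *: w) = qsq u * nsq w.
Proof. by rewrite /nsq mulr_sumr; apply: eq_bigr => a _; rewrite mxE qsqM. Qed.

Lemma sandwich_scale q u w :
  sandwich q (u *: w) = sandwich (qconj u * q * u) w.
Proof. by apply/matrixP => a b; rewrite !mxE qconjM !mulrA. Qed.

Lemma sandwich_unit_scale u w : qsq u = 1 -> sandwich 1 (u *: w) = sandwich 1 w.
Proof. by move=> u1; rewrite sandwich_scale mulr1 qconj_mul u1 qreal1. Qed.

Lemma sandwich_real t q w a b :
  sandwich (qreal t * q) w a b = qreal t * sandwich q w a b.
Proof. by rewrite !mxE !mulrA -qreal_comm. Qed.

(** The Frobenius norm sees |q|, which separates complex projective space,
    where |q| = 1, from the interiors of the balls. *)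
Lemma sandwich_norm q w :
  \sum_a \sum_b qsq (sandwich q w a b) = qsq q * nsq w ^+ 2.
Proof.
transitivity (\sum_a qsq (w 0 a) * (qsq q * nsq w)).
  apply: eq_bigr => a _; rewrite /nsq !mulr_sumr; apply: eq_bigr => b _.
  by rewrite mxE !qsqM qsq_conj; ring.
by rewrite -mulr_suml -/(nsq w); ring.
Qed.

Lemma sum_mul_conj w : \sum_a w 0 a * qconj (w 0 a) = qreal (nsq w).
Proof.
rewrite /nsq (big_morph qreal qrealD qreal0).
by apply: eq_bigr => a _; rewrite qmul_conj.
Qed.

Lemma sandwichK q w : nsq w = 1 ->
  \sum_a \sum_b w 0 a * sandwich q w a b * qconj (w 0 b) = q.
Proof.
move=> w1.
under eq_bigr => a _.
  under eq_bigr => b _ do rewrite mxE !mulrA -mulrA.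
  rewrite -mulr_sumr sum_mul_conj w1 qreal1 mulr1; over.
by rewrite -mulr_suml sum_mul_conj w1 qreal1 mul1r.
Qed.

Lemma sandwich_inj q q' w : nsq w = 1 -> sandwich q w = sandwich q' w -> q = q'.
Proof. by move=> w1 H; rewrite -(sandwichK q w1) H sandwichK. Qed.

(** Take u = w' conj(w)^T, since
    w' = w' conj(w')^T w' = w' conj(w)^T w. *)
Lemma sandwich1_inj w w' : nsq w = 1 -> nsq w' = 1 ->
  sandwich 1 w = sandwich 1 w' -> exists2 u, qsq u = 1 & w' = u *: w.
Proof.
move=> w1 w1' /matrixP H; pose u := \sum_a w' 0 a * qconj (w 0 a).
have uw : w' = u *: w.
  apply/rowP => b; rewrite mxE mulr_suml.
  under eq_bigr => a _.
    have := H a b; rewrite !mxE !mulr1 -mulrA => ->; rewrite mulrA; over.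
  by rewrite -mulr_suml sum_mul_conj w1' qreal1 mul1r.
exists u => //; by move: w1'; rewrite uw nsq_scale w1 mulr1.
Qed.

Lemma sandwich_diag_eq0 w a : (sandwich 1 w a a == 0) = (w 0 a == 0).
Proof. by rewrite mxE mulr1 qconj_mul -qsq_eq0 qsq_real expf_eq0 /= qsq_eq0. Qed.

Lemma nsq_lvec k v t : (k < m)%N ->
  nsq (lvec m k v t) = \sum_(a < k) qsq (v a) + t ^+ 2.
Proof.
move=> km; rewrite /nsq.
pose F b := qsq (if (b < k)%N then v b else if b == k :> nat then qreal t else 0).
rewrite (eq_bigr (fun b : 'I_m => F b)) => [|b _]; last by rewrite mxE.
rewrite -(big_mkord xpredT F) (big_cat_nat (n := k.+1)) //=.
rewrite [X in _ + X](_ : _ = 0) ?addr0; last first.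
  rewrite big_nat big1 // => b /andP[kb _].
  by rewrite /F ltnNge (ltnW kb) /= gtn_eqF // qsq0.
rewrite big_nat_recr //= big_mkord; congr (_ + _).
  by apply: eq_bigr => a _; rewrite /F ltn_ord.
by rewrite /F ltnn eqxx qsq_real.
Qed.

(** The scalar [u] is the phase of the last nonzero coordinate.  If that
    coordinate is complex then so is [u], and division by [u] does not change
    the complex line of [w]. *)
Lemma lvec_normal w (k : 'I_m) : w 0 k != 0 ->
  (forall b : 'I_m, (k < b)%N -> w 0 b = 0) ->
  exists u v t, [/\ qsq u = 1, 0 < t, w = u *: lvec m k v t &
    (w 0 k).2 = 0 -> u * qi = qi * u].
Proof.
move=> wk0 wb0; pose t := Num.sqrt (qsq (w 0 k)).
have t0 : 0 < t by rewrite sqrtr_gt0 qsq_gt0.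
have t2 : t ^+ 2 = qsq (w 0 k) by rewrite sqr_sqrtr // qsq_ge0.
pose u := qreal t^-1 * w 0 k.
have u1 : qsq u = 1.
  by rewrite qsqM qsq_real exprVn t2 mulVf // qsq_eq0.
pose v (j : nat) := if insub j is Some b then qconj u * w 0 b else 0.
exists u, v, t; split => //.
- apply/rowP => b; rewrite !mxE; case: ltngtP => bk.
  + by rewrite /v valK mulrA qmul_conj u1 qreal1 mul1r.
  + by rewrite mulr0 wb0.
  + have -> : b = k by exact/val_inj.
    rewrite /u -[_ * w 0 k * _]mulrA -qreal_comm mulrA -qrealM mulVf ?gt_eqF //.
    by rewrite qreal1 mul1r.
- by move/qcomm_i => H; rewrite /u -mulrA H mulrA qreal_comm mulrA.
Qed.

Lemma sandwich1_lvec_row k (kI : 'I_m) v t a : kI = k :> nat ->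
  sandwich 1 (lvec m k v t) kI a = qreal t * lvec m k v t 0 a.
Proof. by move=> kE; rewrite mxE mulr1 {1}mxE kE ltnn eqxx qconj_real. Qed.

Lemma sandwich_lvec_last q k (kI : 'I_m) v t : kI = k :> nat ->
  sandwich q (lvec m k v t) kI kI = qreal (t ^+ 2) * q.
Proof.
move=> kE; rewrite mxE mxE kE ltnn eqxx qconj_real -mulrA -[q * _]qreal_comm.
by rewrite mulrA -qrealM expr2.
Qed.

Lemma sandwich_continuous (T : topologicalType) (f : T -> quat R)
    (g : T -> 'rV[quat R]_m) :
  continuous f -> (forall a, continuous (fun x => g x 0 a)) ->
  continuous (fun x => sandwich (f x) (g x)).
Proof.
move=> cf cg; apply: matrix_continuous => a b.
rewrite (_ : (fun x => _) = fun x => qconj (g x 0 a) * f x * g x 0 b).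
  exact: (qmul_continuous (qmul_continuous (qconj_continuous (cg a)) cf) (cg b)).
by apply/funext => x; rewrite mxE.
Qed.

Lemma lvec_continuous (T : topologicalType) k (f : T -> nat -> quat R)
    (g : T -> R) a :
  (forall j, (j < k)%N -> continuous (fun x => f x j)) -> continuous g ->
  continuous (fun x => lvec m k (f x) (g x) 0 a).
Proof.
move=> cf cg.
rewrite (_ : (fun x => _) = if (a < k)%N then fun x => f x a else
    if a == k :> nat then fun x => qreal (g x) else fun=> 0).
  case: ifP => [/cf//|_]; case: ifP => _; last exact: cst_continuous.
  exact: qreal_continuous.
by apply/funext => x; rewrite mxE; case: ifP => // _; case: ifP.
Qed.

End dim.
End lines.

(** * Real coordinates of quaternions *)

Section coordinates.
Context {R : realType}.

(** Coordinates are indexed by natural numbers, and vanish out of range, so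
    that no cast is needed between the dimensions 4k+3 and 4(k+1)-1. *)
Definition rcoord p (x : 'rV[R]_p) (j : nat) : R :=
  if insub j is Some i then x 0 i else 0.

Definition qcoord p (x : 'rV[R]_p) (a : nat) : quat R :=
  (rcoord x (4 * a) +i* rcoord x (4 * a).+1,
   rcoord x (4 * a).+2 +i* rcoord x (4 * a).+3).

(** The last three of 4k+3 real coordinates, as an imaginary quaternion. *)
Definition icoord p (x : 'rV[R]_p) (k : nat) : quat R :=
  (0 +i* rcoord x (4 * k), rcoord x (4 * k).+1 +i* rcoord x (4 * k).+2).

Definition qcomp (q : quat R) (c : nat) : R :=
  match c with
  | 0 => complex.Re q.1 | 1 => complex.Im q.1
  | 2 => complex.Re q.2 | _ => complex.Im q.2
  end%N.

(** The inverse of [qcoord] and [icoord]; the real part of [q] is skipped. *)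
Definition pack p k (v : nat -> quat R) (q : quat R) : 'rV[R]_p :=
  \row_j (if (j < 4 * k)%N then qcomp (v (j %/ 4)%N) (j %% 4)
          else qcomp q (j - 4 * k).+1).

Lemma rcoordE p (x : 'rV[R]_p) (i : 'I_p) : rcoord x i = x 0 i.
Proof. by rewrite /rcoord valK. Qed.

Lemma rcoord_continuous p j : continuous (fun x : 'rV[R]_p => rcoord x j).
Proof.
rewrite /rcoord; case: insubP => [i _ _|_]; first exact: entry_continuous.
exact: cst_continuous.
Qed.

Lemma qcoord_continuous p a : continuous (fun x : 'rV[R]_p => qcoord x a).
Proof.
exact: (quat_continuous
  (complex_continuous (@rcoord_continuous p _) (@rcoord_continuous p _))
  (complex_continuous (@rcoord_continuous p _) (@rcoord_continuous p _))).
Qed.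

Lemma icoord_continuous p a : continuous (fun x : 'rV[R]_p => icoord x a).
Proof.
exact: (quat_continuous
  (complex_continuous (@cst_continuous _ _ 0) (@rcoord_continuous p _))
  (complex_continuous (@rcoord_continuous p _) (@rcoord_continuous p _))).
Qed.

Lemma sqnormE p (x : 'rV[R]_p) : sqnorm x = \sum_(0 <= j < p) rcoord x j ^+ 2.
Proof. by rewrite big_mkord; apply: eq_bigr => i _; rewrite rcoordE. Qed.

Lemma sum_quads (f : nat -> R) k :
  \sum_(0 <= j < 4 * k) f j =
  \sum_(a < k) (f (4 * a)%N + f (4 * a).+1 + (f (4 * a).+2 + f (4 * a).+3)).
Proof.
elim: k => [|k IHk]; first by rewrite muln0 big_geq // big_ord0.
rewrite mulnS addnC !addnS addn0 !big_nat_recr //= IHk big_ord_recr /= !addrA.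
by [].
Qed.

Lemma sqnorm_quat k p (x : 'rV[R]_p) : p = (4 * k)%N ->
  sqnorm x = \sum_(a < k) qsq (qcoord x a).
Proof.
move=> pE; have := sum_quads (fun j => rcoord x j ^+ 2) k; rewrite -pE => pS.
by rewrite sqnormE pS.
Qed.

Lemma sqnorm_icoord k p (x : 'rV[R]_p) : p = (4 * k).+3 ->
  sqnorm x = \sum_(a < k) qsq (qcoord x a) + qsq (icoord x k).
Proof.
move=> pE.
have pS (f : nat -> R) : \sum_(0 <= j < p) f j = \sum_(0 <= j < (4 * k).+3) f j.
  by rewrite pE.
rewrite sqnormE pS !big_nat_recr //= sum_quads /qsq /=.
by rewrite expr0n /=; ring.
Qed.

Lemma imaginary_icoord p (x : 'rV[R]_p) k : imaginary (icoord x k).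
Proof. by []. Qed.

Lemma rcoord_pack p k v q j : (j < p)%N -> rcoord (pack p k v q) j =
  if (j < 4 * k)%N then qcomp (v (j %/ 4)%N) (j %% 4)
  else qcomp q (j - 4 * k).+1.
Proof. by move=> jp; rewrite (rcoordE _ (Ordinal jp)) mxE. Qed.

Lemma qcoord_pack p k v q a : (a < k)%N -> (4 * k <= p)%N ->
  qcoord (pack p k v q) a = v a.
Proof.
move=> ak kp.
have E c : (c < 4)%N -> rcoord (pack p k v q) (4 * a + c) = qcomp (v a) c.
  move=> c4; have lt : (4 * a + c < 4 * k)%N by lia.
  rewrite rcoord_pack; last exact: leq_trans lt kp.
  rewrite lt.
  by congr (qcomp (v _) _); lia.
have := E 0%N isT; have := E 1%N isT; have := E 2 isT; have := E 3 isT.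
rewrite addn0 addn1 addn2 addn3 /qcoord => -> -> -> ->.
by case: (v a) => [[? ?] [? ?]].
Qed.

Lemma icoord_pack p k v q : imaginary q -> p = (4 * k).+3 ->
  icoord (pack p k v q) k = q.
Proof.
move=> iq pE.
have E c : (c < 3)%N -> rcoord (pack p k v q) (4 * k + c) = qcomp q c.+1.
  move=> c3; rewrite rcoord_pack; last by rewrite pE; lia.
  by rewrite ltnNge leq_addr /= addKn.
have := E 0%N isT; have := E 1%N isT; have := E 2 isT.
rewrite addn0 addn1 addn2 /icoord => -> -> ->.
by case: q iq {E} => [[a b] [c d]]; rewrite /imaginary /= => ->.
Qed.

Lemma coord_inj k p (x y : 'rV[R]_p) : p = (4 * k).+3 ->
  (forall a, (a < k)%N -> qcoord x a = qcoord y a) -> icoord x k = icoord y k ->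
  x = y.
Proof.
move=> pE xy [E0 E1 E2]; apply/rowP => i; rewrite -!rcoordE.
have [ik|ki] := ltnP i (4 * k).
  have ik4 : (i %/ 4 < k)%N by lia.
  have [] := xy _ ik4; rewrite /= => F0 F1 F2 F3.
  by have [->|[->|[->|->]]] : i = (4 * (i %/ 4))%N :> nat \/ i = (4 * (i %/ 4)).+1 :> nat \/
    i = (4 * (i %/ 4)).+2 :> nat \/ i = (4 * (i %/ 4)).+3 :> nat by lia.
have ip := ltn_ord i; rewrite [X in (_ < X)%N]pE in ip.
by have [->|[->|->]] : i = (4 * k)%N :> nat \/ i = (4 * k).+1 :> nat \/
    i = (4 * k).+2 :> nat by lia.
Qed.

End coordinates.

(** * From a ball to a product of two balls *)

Section elliptic_map.
Context {R : realType}.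
Implicit Types s u S U : R.

(** Put a := [ell s u] and b := [ell u s].  These are the nonnegative numbers
    with b - a = s - u and a b = 1 - s - u.  For s = |v|^2 and u = |q|^2, the
    vectors v' and q' proportional to v and q with |v'|^2 = 1 - a and
    |q'|^2 = 1 - b define a homeomorphism from the unit ball to the product of
    two balls: the interior is a b > 0, and the boundary is a b = 0.  It
    is given by one formula, without a special case at the origin, and its
    inverse is v = v' sqrt(1 - |q'|^2 / 2), q = q' sqrt(1 - |v'|^2 / 2). *)
Definition ell s u : R :=
  (Num.sqrt ((s - u) ^+ 2 + 4 * (1 - s - u)) - (s - u)) / 2.

Lemma ell_sub s u : ell u s - ell s u = s - u.
Proof.
rewrite /ell (_ : (u - s) ^+ 2 + 4 * (1 - u - s) = (s - u) ^+ 2 + 4 * (1 - s - u)).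
  by field.
by ring.
Qed.

Lemma ell_mul s u : s + u <= 1 -> ell s u * ell u s = 1 - s - u.
Proof.
move=> su; rewrite /ell.
rewrite (_ : (u - s) ^+ 2 + 4 * (1 - u - s) = (s - u) ^+ 2 + 4 * (1 - s - u)); last by ring.
set D := Num.sqrt _.
have D2 : D ^+ 2 = (s - u) ^+ 2 + 4 * (1 - s - u).
  by rewrite sqr_sqrtr // addr_ge0 ?sqr_ge0 //; lra.
have -> : (D - (s - u)) / 2 * ((D - (u - s)) / 2) = (D ^+ 2 - (s - u) ^+ 2) / 4.
  by field.
by rewrite D2; field.
Qed.

Lemma ell_ge0 s u : s + u <= 1 -> 0 <= ell s u.
Proof.
move=> su; rewrite divr_ge0 // subr_ge0.
apply: le_trans (ler_norm _) _; rewrite -sqrtr_sqr ler_wsqrtr // lerDl; lra.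
Qed.

(** This is |v'|^2 = 1 - a for v' = sqrt(2 / (1 + b)) v. *)
Lemma ell_scale s u : s + u <= 1 -> s * 2 = (1 - ell s u) * (1 + ell u s).
Proof.
by move=> su; have := ell_sub s u; have := ell_mul su; nra.
Qed.

(** The radicand is (2 - S - U)^2, because a = 1 - S and b = 1 - U. *)
Lemma ellK S U : 0 <= S <= 1 -> 0 <= U <= 1 ->
  ell (S * (1 - U / 2)) (U * (1 - S / 2)) = 1 - S.
Proof.
move=> S01 U01; rewrite /ell.
set X := (X in Num.sqrt X); have -> : X = (2 - S - U) ^+ 2 by rewrite /X; field.
by rewrite sqrtr_sqr ger0_norm; [field|lra].
Qed.

End elliptic_map.

(** * The cells of the ball bundle *)

Section bundle_cells.
Context {R : realType} {n : nat}.
Implicit Types (q u : quat R) (t : R) (w : 'rV[quat R]_n.+1).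

(** The first matrix records a quaternionic line, and the second one a point
    of the ball over it. *)
Definition ambient : topologicalType :=
  ('M[quat R]_n.+1 * 'M[quat R]_n.+1)%type.

Lemma ambient_hausdorff : hausdorff_space ambient.
Proof.
by apply: prod_hausdorff; apply: matrix_hausdorff; exact: quat_hausdorff.
Qed.

(** The point [q] of the ball over the quaternionic line of [w].  Replacing
    [w] by [u w] rotates the ball, see [ball_point_unit_scale]. *)
Definition ball_point q w : ambient := (sandwich 1 w, sandwich q w).

Lemma ball_point_continuous (T : topologicalType) (f : T -> quat R)
    (g : T -> 'rV[quat R]_n.+1) :
  continuous f -> (forall a, continuous (fun x => g x 0 a)) ->
  continuous (fun x => ball_point (f x) (g x)).
Proof.
move=> cf cg x.
have c1 := sandwich_continuous (@cst_continuous T (quat R) 1) cg.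
have c2 := sandwich_continuous cf cg.
exact: (@cvg_pair _ _ _ (nbhs x) (nbhs _) (nbhs _) _ _ _ _ _ (c1 x) (c2 x)).
Qed.

Lemma ball_point_unit_scale q u w : qsq u = 1 ->
  ball_point q (u *: w) = ball_point (qconj u * q * u) w.
Proof. by move=> u1; rewrite /ball_point sandwich_unit_scale // sandwich_scale. Qed.

(** The factor sqrt(2 / (1 + e)) of the elliptic map. *)
Definition rescale (e : R) : R := (Num.sqrt ((1 + e) / 2))^-1.

Lemma rescale_gt0 (e : R) : 0 <= e -> 0 < rescale e.
Proof. by move=> e0; rewrite invr_gt0 sqrtr_gt0 divr_gt0 // ltr_wpDr. Qed.

Lemma rescale_sqr (e : R) : 0 <= e -> rescale e ^+ 2 = 2 / (1 + e).
Proof.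
move=> e0; rewrite /rescale exprVn sqr_sqrtr ?invf_div //.
by rewrite divr_ge0 // addr_ge0.
Qed.

Section cell.
Context {p : nat} (k : nat).
Hypothesis pE : p = (4 * k).+3.
Hypothesis kn : (k < n.+1)%N.
Implicit Types x y : 'rV[R]_p.

Let s x : R := \sum_(a < k) qsq (qcoord x a).
Let u x : R := qsq (icoord x k).
Let A x := ell (s x) (u x).
Let B x := ell (u x) (s x).

Definition cell_dir x : quat R := qreal (rescale (A x)) * icoord x k.
Definition cell_vec x (a : nat) : quat R := qreal (rescale (B x)) * qcoord x a.
(** The ball of dimension 4k+3 is mapped to the product of the unit ball of
    H^k and of a 3-ball.  The point (v', q') obtained in this way goes to the
    point q' of the ball over the line of (v', sqrt(1 - |v'|^2)), where
    1 - |v'|^2 = [A x]. *)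
Definition cell_map x : ambient :=
  ball_point (cell_dir x) (lvec n.+1 k (cell_vec x) (Num.sqrt (A x))).

Let su x : s x + u x = sqnorm x.
Proof. by rewrite (sqnorm_icoord x pE). Qed.

Let A_ge0 x : disk R p x -> 0 <= A x.
Proof. by move=> x1; apply: ell_ge0; rewrite su. Qed.

Let B_ge0 x : disk R p x -> 0 <= B x.
Proof. by move=> x1; apply: ell_ge0; rewrite addrC su. Qed.

Let AB x : disk R p x -> A x * B x = 1 - sqnorm x.
Proof. by move=> x1; rewrite -su opprD addrA; apply: ell_mul; rewrite su. Qed.

Lemma cell_vec_norm x : disk R p x ->
  \sum_(a < k) qsq (cell_vec x a) = 1 - A x.
Proof.
move=> x1; rewrite /cell_vec.
under eq_bigr => a _ do rewrite qsqM qsq_real.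
rewrite -mulr_sumr -/(s x) rescale_sqr ?B_ge0 //.
have B1 : 1 + B x != 0 by apply: lt0r_neq0; apply: ltr_wpDr => //; exact: B_ge0.
rewrite mulrAC [2 * _]mulrC (@ell_scale _ (s x) (u x)); last by rewrite su.
by rewrite -/(A x) -/(B x) mulfK.
Qed.

Lemma cell_dir_norm x : disk R p x -> qsq (cell_dir x) = 1 - B x.
Proof.
move=> x1; rewrite qsqM qsq_real rescale_sqr ?A_ge0 //.
have A1 : 1 + A x != 0 by apply: lt0r_neq0; apply: ltr_wpDr => //; exact: A_ge0.
rewrite mulrAC [2 * _]mulrC (@ell_scale _ (u x) (s x)); last by rewrite addrC su.
by rewrite -/(A x) -/(B x) mulfK.
Qed.

Lemma cell_dir_imaginary x : imaginary (cell_dir x).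
Proof. exact/imaginary_real/imaginary_icoord. Qed.

Lemma cell_lvec_norm x : disk R p x ->
  nsq (lvec n.+1 k (cell_vec x) (Num.sqrt (A x))) = 1.
Proof.
by move=> x1; rewrite nsq_lvec // cell_vec_norm // sqr_sqrtr ?A_ge0 // subrK.
Qed.

Lemma cell_dir_le1 x : disk R p x -> qsq (cell_dir x) <= 1.
Proof. by move=> x1; rewrite cell_dir_norm // gerBl B_ge0. Qed.

Lemma cell_interior x : sqnorm x < 1 -> 0 < Num.sqrt (A x) /\ qsq (cell_dir x) < 1.
Proof.
move=> x1; have dx : disk R p x by exact: ltW.
have ab : 0 < A x * B x by rewrite AB // subr_gt0.
have [a0 b0] := (A_ge0 dx, B_ge0 dx).
have Ap : 0 < A x by rewrite lt_def a0 andbT; apply: contraTneq ab => ->; rewrite mul0r ltxx.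
have Bp : 0 < B x by rewrite lt_def b0 andbT; apply: contraTneq ab => ->; rewrite mulr0 ltxx.
by rewrite sqrtr_gt0 cell_dir_norm // ltrBlDr ltrDl.
Qed.

(** The boundary of the product of two balls: either q' is on its sphere, and
    the point is a complex line, or v' is, and the line is in a lower cell. *)
Lemma cell_boundary x : sqnorm x = 1 ->
  qsq (cell_dir x) = 1 \/ Num.sqrt (A x) = 0.
Proof.
move=> x1; have dx : disk R p x by rewrite /disk /= x1.
have /eqP : A x * B x = 0 by rewrite AB // x1 subrr.
rewrite mulf_eq0 => /orP[/eqP ->|/eqP Bx]; first by right; rewrite sqrtr0.
by left; rewrite cell_dir_norm // Bx subr0.
Qed.

Lemma cell_map_continuous : continuous (fun x : disk R p => cell_map (\val x)).
Proof.
have cv := @set_val_continuous _ (disk R p).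
have csum : continuous (fun x : disk R p => s (\val x)).
  apply: (comp_continuous _ cv).
  apply: sum_continuous => a; exact: qsq_continuous (@qcoord_continuous _ _ _).
have cu : continuous (fun x : disk R p => u (\val x)).
  apply: (comp_continuous _ cv).
  exact: qsq_continuous (@icoord_continuous _ _ _).
have cell_cont (f g : disk R p -> R) : continuous f -> continuous g ->
    continuous (fun x : disk R p => ell (f x) (g x)).
  move=> cf cg.
  have cfg := addr_continuous cf (oppr_continuous cg).
  have c1 := addr_continuous (addr_continuous (@cst_continuous _ R 1) (oppr_continuous cf)) (oppr_continuous cg).
  have c2 := addr_continuous (@exprr_continuous _ _ _ 2 cfg) (mulr_continuous (@cst_continuous _ R 4) c1).
  have c3 := addr_continuous (sqrtr_continuous c2) (oppr_continuous cfg).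
  exact: (mulr_continuous c3 (@cst_continuous _ R 2^-1)).
have resc (f : disk R p -> R) : continuous f -> (forall x : disk R p, 0 <= f x) ->
    continuous (fun x : disk R p => rescale (f x)).
  move=> cf f0.
  have c1 := mulr_continuous (addr_continuous (@cst_continuous _ R 1) cf) (@cst_continuous _ R 2^-1).
  apply: (invr_continuous (sqrtr_continuous c1)) => x.
  by rewrite gt_eqF // sqrtr_gt0 divr_gt0 // ltr_wpDr.
have cA := cell_cont _ _ csum cu; have cB := cell_cont _ _ cu csum.
have dv (x : disk R p) : disk R p (\val x) by exact: set_valP.
have rA := resc _ cA (fun x : disk R p => A_ge0 (dv x)).
have rB := resc _ cB (fun x : disk R p => B_ge0 (dv x)).
apply: ball_point_continuous.
  exact: (qmul_continuous (qreal_continuous rA) (comp_continuous (@icoord_continuous _ _ _) cv)).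
move=> a; apply: lvec_continuous; last exact: sqrtr_continuous.
move=> j _.
exact: (qmul_continuous (qreal_continuous rB) (comp_continuous (@qcoord_continuous _ _ _) cv)).
Qed.

(** The entries in position k of the two matrices are t^2 and t^2 q', and row
    k of the first one is t (v', t); here t > 0, so that v' and q' can be
    recovered. *)
Lemma cell_map_inj x y : sqnorm x < 1 -> sqnorm y < 1 ->
  cell_map x = cell_map y -> x = y.
Proof.
move=> x1 y1 [/matrixP E1 /matrixP E2].
have [dx dy] : disk R p x /\ disk R p y by split; exact: ltW.
pose kI : 'I_n.+1 := Ordinal kn.
have [Ax _] := cell_interior x1; have [Ay _] := cell_interior y1.
have Axy : A x = A y.
  have := E1 kI kI; rewrite !sandwich_lvec_last // !mulr1 => /qreal_inj.
  by rewrite !sqr_sqrtr ?A_ge0.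
have Dxy : cell_dir x = cell_dir y.
  have := E2 kI kI; rewrite !sandwich_lvec_last // Axy; apply: qreal_mulI.
  by rewrite expf_eq0 /= gt_eqF.
have Vxy a : (a < k)%N -> cell_vec x a = cell_vec y a.
  move=> ak; have an : (a < n.+1)%N by exact: ltn_trans kn.
  have := E1 kI (Ordinal an); rewrite !sandwich1_lvec_row // Axy !mxE ak /=.
  by apply: qreal_mulI; rewrite gt_eqF.
have Bxy : B x = B y.
  by have := cell_dir_norm dx; rewrite Dxy cell_dir_norm // => /addrI/oppr_inj.
apply: (coord_inj pE) => [a /Vxy|]; rewrite /cell_vec /cell_dir ?Bxy.
  by apply: qreal_mulI; rewrite gt_eqF // rescale_gt0 // B_ge0.
move: Dxy; rewrite /cell_dir Axy; apply: qreal_mulI.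
by rewrite gt_eqF // rescale_gt0 // A_ge0.
Qed.

Lemma cell_map_surj q (v : nat -> quat R) t : imaginary q -> qsq q <= 1 -> 0 <= t ->
  \sum_(a < k) qsq (v a) + t ^+ 2 = 1 ->
  exists x, [/\ disk R p x, cell_map x = ball_point q (lvec n.+1 k v t) &
    (qsq q < 1 -> 0 < t -> sqnorm x < 1)].
Proof.
move=> iq q1 t0 vt; pose S := 1 - t ^+ 2; pose U := qsq q.
have vS : \sum_(a < k) qsq (v a) = S by rewrite /S -vt addrK.
have S0 : 0 <= S by rewrite -vS sumr_ge0 // => a _; exact: qsq_ge0.
have S1 : S <= 1 by rewrite gerBl sqr_ge0.
have U0 : 0 <= U by exact: qsq_ge0.
have S2 : 0 < 1 - S / 2 by lra.
have U2 : 0 < 1 - U / 2 by rewrite /U; lra.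
pose c := Num.sqrt (1 - U / 2); pose d := Num.sqrt (1 - S / 2).
have c2 : c ^+ 2 = 1 - U / 2 by rewrite sqr_sqrtr // ltW.
have d2 : d ^+ 2 = 1 - S / 2 by rewrite sqr_sqrtr // ltW.
have c0 : c != 0 by rewrite gt_eqF // sqrtr_gt0.
have d0 : d != 0 by rewrite gt_eqF // sqrtr_gt0.
(* The inverse of the elliptic map. *)
pose x : 'rV[R]_p := pack p k (fun a => qreal c * v a) (qreal d * q).
have xv a : (a < k)%N -> qcoord x a = qreal c * v a.
  by move=> ak; rewrite qcoord_pack // pE; lia.
have xq : icoord x k = qreal d * q by rewrite icoord_pack //; exact: imaginary_real.
have sx : s x = S * (1 - U / 2).
  rewrite /s; under eq_bigr => a _ do rewrite xv // qsqM qsq_real.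
  by rewrite -mulr_sumr vS c2 mulrC.
have ux : u x = U * (1 - S / 2) by rewrite /u xq qsqM qsq_real d2 mulrC.
have xE : sqnorm x = 1 - (1 - S) * (1 - U) by rewrite -su sx ux; field.
have Ax : A x = 1 - S by rewrite /A sx ux ellK // ?S0 ?U0.
have Bx : B x = 1 - U by rewrite /B sx ux ellK // ?S0 ?U0.
exists x; split.
- by rewrite /disk /= xE gerBl mulr_ge0 // subr_ge0.
- rewrite /cell_map Ax (_ : 1 - S = t ^+ 2); last by rewrite /S opprB addrC subrK.
  rewrite sqrtr_sqr ger0_norm //; congr ball_point.
    rewrite /cell_dir xq mulrA -qrealM Ax /rescale.
    rewrite (_ : (1 + (1 - S)) / 2 = 1 - S / 2) -/d; last by field.
    by rewrite mulVf // qreal1 mul1r.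
  apply/rowP => b; rewrite !mxE; case: ifP => // bk.
  rewrite /cell_vec xv // mulrA -qrealM Bx /rescale.
  rewrite (_ : (1 + (1 - U)) / 2 = 1 - U / 2) -/c; last by field.
  by rewrite mulVf // qreal1 mul1r.
- move=> q1' t0'; rewrite xE ltrBlDr ltrDl mulr_gt0 // subr_gt0 //.
  by rewrite gtrBl exprn_gt0.
Qed.

End cell.
End bundle_cells.

(** * Complex lines as points of the ball bundle *)

Section normalization.
Context {R : realType} {m : nat}.
Implicit Types (u : quat R) (w : 'rV[quat R]_m).

(** Only the positive real factor is removed; the phase of [w] is kept. *)
Definition unitize w := qreal (Num.sqrt (nsq w))^-1 *: w.

Lemma nsq_gt0 w : (0 < nsq w) = (w != 0).
Proof. by rewrite lt_def nsq_ge0 andbT nsq_eq0. Qed.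

Lemma sqrt_nsq_neq0 w : w != 0 -> Num.sqrt (nsq w) != 0.
Proof. by move=> w0; rewrite gt_eqF // sqrtr_gt0 nsq_gt0. Qed.

Lemma nsq_unitize w : w != 0 -> nsq (unitize w) = 1.
Proof.
move=> w0; rewrite nsq_scale qsq_real exprVn sqr_sqrtr ?nsq_ge0 //.
by rewrite mulVf // nsq_eq0.
Qed.

Lemma unitizeK w : w != 0 -> qreal (Num.sqrt (nsq w)) *: unitize w = w.
Proof.
move=> w0; rewrite scalerA -qrealM divff ?sqrt_nsq_neq0 //.
by rewrite qreal1 scale1r.
Qed.

Lemma unitize_id w : nsq w = 1 -> unitize w = w.
Proof. by move=> w1; rewrite /unitize w1 sqrtr1 invr1 qreal1 scale1r. Qed.

Lemma unitize_scale u w : u != 0 ->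
  unitize (u *: w) = (qreal (Num.sqrt (qsq u))^-1 * u) *: unitize w.
Proof.
move=> u0; rewrite /unitize !scalerA; congr (_ *: w).
rewrite nsq_scale sqrtrM ?qsq_ge0 // invfM qrealM.
by rewrite -!mulrA; congr (_ * _); rewrite qreal_comm.
Qed.

Lemma qsq_unit_part u : u != 0 -> qsq (qreal (Num.sqrt (qsq u))^-1 * u) = 1.
Proof.
move=> u0; rewrite qsqM qsq_real exprVn sqr_sqrtr ?qsq_ge0 //.
by rewrite mulVf // qsq_eq0.
Qed.

Lemma unitize_continuous (T : topologicalType) (f : T -> 'rV[quat R]_m) a :
  (forall a, continuous (fun x => f x 0 a)) -> (forall x, f x != 0) ->
  continuous (fun x => unitize (f x) 0 a).
Proof.
move=> cf f0.
rewrite (_ : (fun x => _) =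
    fun x => qreal (Num.sqrt (nsq (f x)))^-1 * f x 0 a); last first.
  by apply/funext => x; rewrite mxE.
have cn : continuous (fun x => nsq (f x)).
  apply: sum_continuous => b; exact: (qsq_continuous (cf b)).
have ci := invr_continuous (sqrtr_continuous cn) (fun x => sqrt_nsq_neq0 (f0 x)).
exact: (qmul_continuous (qreal_continuous ci) (cf a)).
Qed.

End normalization.

Section complex_vectors.
Context {R : realType}.

Definition zcoord m (z : 'rV[cplx R]_m) (j : nat) : cplx R :=
  if insub j is Some i then z 0 i else 0.

Lemma zcoordE m (z : 'rV[cplx R]_m) (i : 'I_m) : zcoord z i = z 0 i.
Proof. by rewrite /zcoord valK. Qed.

Lemma zcoord_out m (z : 'rV[cplx R]_m) j : (m <= j)%N -> zcoord z j = 0.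
Proof. by move=> mj; rewrite /zcoord insubN // -leqNgt. Qed.

Lemma zcoord_scale m (z : 'rV[cplx R]_m) (c : cplx R) j :
  zcoord (c *: z) j = c * zcoord z j.
Proof. by rewrite /zcoord; case: insubP => [i _ _|_]; rewrite ?mxE ?mulr0. Qed.

Lemma zcoord_continuous m j : continuous (fun z : 'rV[cplx R]_m => zcoord z j).
Proof.
rewrite /zcoord; case: insubP => [i _ _|_]; first exact: entry_continuous.
exact: cst_continuous.
Qed.

Context {n : nat}.

(** The row (z_0 + z_1 j, z_2 + z_3 j, ..., z_(2n)).  This identifies
    C^(2n+1) with the rows of H^(n+1) whose last coordinate is complex. *)
Definition quaternify (z : 'rV[cplx R]_(2 * n).+1) : 'rV[quat R]_n.+1 :=
  \row_a (zcoord z (2 * a), zcoord z (2 * a).+1).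

Definition complexify (w : 'rV[quat R]_n.+1) : 'rV[cplx R]_(2 * n).+1 :=
  \row_j (if odd j then (w 0 (inord (j./2))).2 else (w 0 (inord (j./2))).1).

Lemma quaternify_scale (c : cplx R) z :
  quaternify (c *: z) = ((c, 0) : quat R) *: quaternify z.
Proof.
apply/rowP => a; rewrite !mxE !zcoord_scale.
apply: quatP => /=; by rewrite mul0r ?subr0 ?addr0.
Qed.

Lemma quaternify_inj : injective quaternify.
Proof.
move=> z z' /rowP E; apply/rowP => j; rewrite -!zcoordE.
have jn : (j./2 < n.+1)%N by have := ltn_ord j; lia.
have := E (Ordinal jn); rewrite !mxE /= => -[E1 E2].
by have [->|->] : j = (2 * j./2)%N :> nat \/ j = (2 * j./2).+1 :> nat by lia.
Qed.

Lemma quaternify0 : quaternify 0 = 0.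
Proof.
apply/rowP => a; rewrite !mxE /zcoord.
by do 2!case: insubP => [? _ _|_]; rewrite ?mxE.
Qed.

Lemma quaternify_neq0 z : z != 0 -> quaternify z != 0.
Proof. by rewrite -quaternify0 (inj_eq quaternify_inj). Qed.

Lemma quaternify_last z : (quaternify z 0 ord_max).2 = 0.
Proof. by rewrite mxE /= zcoord_out. Qed.

Lemma complexifyK (w : 'rV[quat R]_n.+1) : (w 0 ord_max).2 = 0 ->
  quaternify (complexify w) = w.
Proof.
move=> wn; apply/rowP => a; rewrite mxE; have an := ltn_ord a.
have aE : inord a = a by apply/val_inj; rewrite /= inordK.
apply: quatP => /=.
  have lt : (2 * a < (2 * n).+1)%N by lia.
  rewrite (zcoordE _ (Ordinal lt)) mxE /= mul2n odd_double doubleK aE //.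
have [lt|ge] := ltnP (2 * a).+1 (2 * n).+1.
  rewrite (zcoordE _ (Ordinal lt)) mxE /= mul2n odd_double /=.
  by rewrite uphalf_double aE.
rewrite zcoord_out //; have -> : a = ord_max by apply/val_inj => /=; lia.
by rewrite wn.
Qed.

Lemma quaternify_continuous a :
  continuous (fun z : 'rV[cplx R]_(2 * n).+1 => quaternify z 0 a).
Proof.
rewrite (_ : (fun z => _) = fun z => (zcoord z (2 * a), zcoord z (2 * a).+1) : quat R).
  exact: (quat_continuous (@zcoord_continuous _ _) (@zcoord_continuous _ _)).
by apply/funext => z; rewrite mxE.
Qed.

(** A complex line is the point i of the ball over the quaternionic line that
    it spans.  This does not depend on the vector chosen in the complex line
    ([line_point_scale]). *)
Definition line_point (z : 'rV[cplx R]_(2 * n).+1) : ambient :=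
  ball_point qi (unitize (quaternify z)).

Lemma ball_point_commute (u : quat R) (w : 'rV[quat R]_n.+1) :
  qsq u = 1 -> u * qi = qi * u -> ball_point qi (u *: w) = ball_point qi w.
Proof.
by move=> u1 ui; rewrite ball_point_unit_scale // -mulrA -ui mulrA qconj_mul u1 qreal1 mul1r.
Qed.

Lemma line_point_scale (c : cplx R) z : c != 0 -> line_point (c *: z) = line_point z.
Proof.
move=> c0; have c0' : ((c, 0) : quat R) != 0 by rewrite xpair_eqE negb_and c0.
rewrite /line_point quaternify_scale unitize_scale //.
rewrite ball_point_commute // ?qsq_unit_part //.
by apply/qcomm_i => /=; rewrite mulr0 mul0r addr0.
Qed.

(** Equality of the projectors gives a unit quaternion [u] between the two
    rows, and equality of the second matrices forces [u] to commute with i,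
    that is, to be complex. *)
Lemma line_point_inj z z' : z != 0 -> z' != 0 -> line_point z = line_point z' ->
  exists2 c : cplx R, c != 0 & z' = c *: z.
Proof.
move=> z0 z0' [E1 E2]; have w0 := quaternify_neq0 z0.
have w0' := quaternify_neq0 z0'.
have [u u1 uE] := sandwich1_inj (nsq_unitize w0) (nsq_unitize w0') E1.
move: E2; rewrite uE sandwich_scale => /(sandwich_inj (nsq_unitize w0)) ui.
have u2 : u.2 = 0.
  apply/qcomm_i; rewrite [in LHS]ui !mulrA qmul_conj u1 qreal1 mul1r.
  by [].
pose c : cplx R := (Num.sqrt (nsq (quaternify z')) / Num.sqrt (nsq (quaternify z)))%:C * u.1.
have zE : z' = c *: z.
  apply: quaternify_inj; rewrite quaternify_scale -(unitizeK w0') uE /unitize !scalerA.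
  congr (_ *: _); rewrite -!mulrA -[u * _]qreal_comm mulrA -qrealM.
  by apply: quatP => /=; rewrite ?u2 ?mulr0 ?mul0r ?conjc0 ?oppr0 ?subr0 ?addr0 ?mulr0 //.
exists c => //; apply: contra_neq z0' => c0; by rewrite zE c0 scale0r.
Qed.

Lemma line_point_continuous :
  continuous (fun z : nonzero_vec (cplx R) (2 * n).+1 => line_point (\val z)).
Proof.
have cv := @set_val_continuous _ (nonzero_vec (cplx R) (2 * n).+1).
apply: ball_point_continuous; first exact: cst_continuous.
move=> a; apply: unitize_continuous.
  move=> b; exact: (comp_continuous (@quaternify_continuous b) cv).
by move=> z; apply: quaternify_neq0; exact: (set_valP z).
Qed.

End complex_vectors.

(** * The cell structure of complex projective space *)

Section complex_projective_cells.
Context {R : realType} {m : nat}.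
Local Notation vec := (nonzero_vec (cplx R) m.+1).

Definition cp_class (v : vec) : CP R m := \pi_{eq_quot line_equiv (cplx R) m.+1} v.

(** The real squared modulus; the norm of [R[i]] has its values in [R[i]]. *)
Definition csq (z : cplx R) : R := complex.Re z ^+ 2 + complex.Im z ^+ 2.

Lemma csq_ge0 z : 0 <= csq z.
Proof. by rewrite addr_ge0 // sqr_ge0. Qed.

Lemma csq_eq0 z : (csq z == 0) = (z == 0).
Proof.
case: z => a b; rewrite /csq /= paddr_eq0 ?sqr_ge0 // !sqrf_eq0 eq_complex //.
Qed.

Lemma csqM z z' : csq (z * z') = csq z * csq z'.
Proof. by case: z z' => [a b] [c d]; rewrite /csq /=; ring. Qed.

Lemma csq_real (x : R) : csq x%:C = x ^+ 2.
Proof. by rewrite /csq /= expr0n addr0. Qed.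

Lemma cp_class_surj (y : CP R m) : exists v, y = cp_class v.
Proof. by exists (repr y); rewrite /cp_class reprK. Qed.

Lemma cp_classP (v w : vec) :
  cp_class v = cp_class w <-> exists2 c : cplx R, c != 0 & \val w = c *: \val v.
Proof.
split=> [/eqmodP/asboolP[c cu ->]|[c c0 wE]].
  by exists c; rewrite // -unitfE.
by apply/eqmodP/asboolP; exists c; rewrite ?unitfE.
Qed.

Lemma zcoord_cell_vec (i : 'I_m.+1) (x : 'rV[R]_(i + i)) (j : 'I_i) :
  zcoord (CP_cell_vec x) j = (x 0 (lshift i j) +i* x 0 (rshift i j)).
Proof.
have jm : (j < m.+1)%N by exact: ltn_trans (ltn_ord j) (ltn_ord i).
by rewrite (zcoordE _ (Ordinal jm)) mxE /= valK.
Qed.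

Lemma cell_vec_last (i : 'I_m.+1) (x : 'rV[R]_(i + i)) :
  CP_cell_vec x 0 i = (Num.sqrt (1 - sqnorm x))%:C.
Proof. by rewrite mxE insubN ?ltnn // eqxx. Qed.

Lemma cell_vec_above (i : 'I_m.+1) (x : 'rV[R]_(i + i)) (b : 'I_m.+1) :
  (i < b)%N -> CP_cell_vec x 0 b = 0.
Proof.
move=> ib; rewrite mxE insubN; last by rewrite -leqNgt ltnW.
by rewrite ifN // -val_eqE /= gtn_eqF.
Qed.

Lemma sqnorm_double (i : nat) (x : 'rV[R]_(i + i)) :
  sqnorm x = \sum_(j < i) csq (x 0 (lshift i j) +i* x 0 (rshift i j)).
Proof. by rewrite /sqnorm big_split_ord /= -big_split. Qed.

Lemma CP_charE (i : 'I_m.+1) (x : disk R (i + i)) :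
  exists2 v : vec, CP_char x = cp_class v & \val v = CP_cell_vec (\val x).
Proof. by eexists. Qed.

Lemma CP_char_continuous (i : 'I_m.+1) : continuous (@CP_char R m i).
Proof.
have cpi : continuous cp_class by exact: pi_continuous.
apply: (comp_continuous cpi); apply: set_type_continuous => /=.
apply: (comp_continuous _ (@set_val_continuous _ (disk R (i + i)))).
apply: matrix_continuous => a b.
rewrite (_ : (fun x => _) = if insub (b : nat) is Some j then
     (fun x : 'rV_(i + i) => x 0 (lshift i j) +i* x 0 (rshift i j) : cplx R) else
   if b == i then fun x => (Num.sqrt (1 - sqnorm x))%:C else fun=> 0).
  case: insubP => [j _ _|_].
    exact: (complex_continuous (@entry_continuous _ _ _ _ _) (@entry_continuous _ _ _ _ _)).
  case: ifP => _; last exact: cst_continuous.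
  have c1 := addr_continuous (@cst_continuous _ R 1) (oppr_continuous (@sqnorm_continuous R (i + i))).
  exact: (comp_continuous (@real_complex_continuous R) (sqrtr_continuous c1)).
by apply/funext => x; rewrite mxE; case: insubP => // _; case: ifP.
Qed.

Lemma open_cell_last (i : 'I_m.+1) (v : vec) :
  open_cell (X := CP_cells R m) i (cp_class v) ->
  \val v 0 i != 0 /\ forall b : 'I_m.+1, (i < b)%N -> \val v 0 b = 0.
Proof.
move=> [x ix /= xv]; have [w wE wx] := CP_charE x.
move: xv; rewrite wE => /cp_classP[c c0 ->]; rewrite wx.
split=> [|b ib]; last by rewrite mxE cell_vec_above // mulr0.
rewrite mxE cell_vec_last mulf_eq0 negb_or c0 /=.
rewrite -csq_eq0 csq_real sqrf_eq0 gt_eqF // sqrtr_gt0 subr_gt0.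
exact: ix.
Qed.

(** The cell is given by the last nonzero coordinate; the point has a unique
    representative of norm 1 where this coordinate is a positive real. *)
Lemma open_cell_exists (v : vec) : exists2 i : 'I_m.+1, \val v 0 i != 0 &
  open_cell (X := CP_cells R m) i (cp_class v).
Proof.
have v0 : \val v != 0 by exact: (set_valP v).
have [i vi above] := last_nonzero v0.
pose N : R := \sum_(j < i) csq (zcoord (\val v) j) + csq (\val v 0 i).
have vi0 : 0 < csq (\val v 0 i) by rewrite lt_def csq_ge0 csq_eq0 vi.
have N0 : 0 < N.
  by rewrite ltr_wpDl // sumr_ge0 // => j _; exact: csq_ge0.
(* This divides by the norm and by the phase of the last nonzero coordinate. *)
pose c : cplx R := (Num.sqrt N * Num.sqrt (csq (\val v 0 i)))^-1%:C * conjc (\val v 0 i).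
have cv : c * \val v 0 i = (Num.sqrt (csq (\val v 0 i) / N))%:C.
  have -> : c * \val v 0 i =
      ((Num.sqrt N * Num.sqrt (csq (\val v 0 i)))^-1 * csq (\val v 0 i))%:C.
    rewrite /c -mulrA rmorphM; congr (_ * _).
    case: (\val v 0 i) => a b; apply/eqP; rewrite eq_complex /csq /=.
    by apply/andP; split; apply/eqP; ring.
  congr (_%:C); rewrite sqrtrM ?csq_ge0 // sqrtrV ?(ltW N0) //.
  rewrite -[X in _ * X](sqr_sqrtr (ltW vi0)) invfM -mulrA mulrC.
  by rewrite expr2 mulrA mulVf ?mul1r // gt_eqF // sqrtr_gt0.
have cN : csq c = N^-1.
  have : csq (c * \val v 0 i) = csq (\val v 0 i) / N.
    by rewrite cv csq_real sqr_sqrtr // divr_ge0 // ltW.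
  by rewrite csqM mulrC => /(mulfI (lt0r_neq0 vi0)).
have c0 : c != 0 by rewrite -csq_eq0 cN invr_eq0 gt_eqF.
pose x : 'rV[R]_(i + i) := \row_(k < i + i)
  match fintype.split k with
  | inl j => complex.Re (c * zcoord (\val v) j)
  | inr j => complex.Im (c * zcoord (\val v) j)
  end.
have xE (j : 'I_i) : (x 0 (lshift i j) +i* x 0 (rshift i j)) = c * zcoord (\val v) j.
  rewrite !mxE (unsplitK (inl j)) (unsplitK (inr j)).
  by case: (c * _).
have xN : sqnorm x = 1 - csq (\val v 0 i) / N.
  rewrite sqnorm_double; under eq_bigr => j _ do rewrite xE csqM cN.
  rewrite -mulr_sumr -(mulVf (lt0r_neq0 N0)) {2}/N.
  by rewrite [_ / N]mulrC -mulrBr addrK.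
have xlt : sqnorm x < 1 by rewrite xN gtrBl divr_gt0.
pose dx : disk R (i + i) := exist _ x (mem_set (ltW xlt : disk R _ x)).
exists i => //; exists dx; first exact: xlt.
have [w wd wE] := CP_charE dx; change (CP_char dx = cp_class v); rewrite wd.
apply/esym/cp_classP; exists c => //; rewrite wE /=.
apply/rowP => b; rewrite -!zcoordE; case: (ltngtP b i) => [bi|ib|bi].
- by rewrite (zcoord_cell_vec x (Ordinal bi)) xE zcoord_scale.
- by rewrite !zcoordE cell_vec_above // mxE above // mulr0.
- rewrite !zcoordE (_ : b = i); last exact/val_inj.
  by rewrite cell_vec_last mxE cv xN opprB addrC subrK.
Qed.

(** Two such representatives differ by a scalar that is a positive real, as
    it relates their last coordinates, and has modulus 1, as it relates their
    norms. *)
Lemma CP_char_inj (i : 'I_m.+1) :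
  {in @disk_interior R (i + i) &, injective (@CP_char R m i)}.
Proof.
move=> x y; rewrite !inE /disk_interior /= => ix iy.
have [v -> vE] := CP_charE x; have [w -> wE] := CP_charE y.
move=> /cp_classP[c c0 wc]; rewrite vE wE in wc.
have cL : CP_cell_vec (\val y) 0 i = c * CP_cell_vec (\val x) 0 i.
  by rewrite wc [LHS]mxE.
rewrite !cell_vec_last in cL.
have Lx : 0 < Num.sqrt (1 - sqnorm (\val x)) by rewrite sqrtr_gt0 subr_gt0.
have Ly : 0 < Num.sqrt (1 - sqnorm (\val y)) by rewrite sqrtr_gt0 subr_gt0.
have yx (j : 'I_i) : \val y 0 (lshift i j) +i* \val y 0 (rshift i j) =
    c * (\val x 0 (lshift i j) +i* \val x 0 (rshift i j)).
  by rewrite -!zcoord_cell_vec wc zcoord_scale.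
have yN : sqnorm (\val y) = csq c * sqnorm (\val x).
  by rewrite !sqnorm_double mulr_sumr; apply: eq_bigr => j _; rewrite yx csqM.
have cN : csq c = 1.
  have := congr1 csq cL; rewrite csqM !csq_real !sqr_sqrtr ?subr_ge0 ?ltW //.
  by rewrite yN; lra.
have c1 : c = 1.
  move: cL cN; case: (c) => a b; rewrite /csq /= => -[La Lb] ab.
  have b0 : b = 0.
    move: Lb; rewrite mulr0 add0r => /esym/eqP; rewrite mulf_eq0 (gt_eqF Lx) orbF.
    by move/eqP.
  have a0 : 0 < a.
    by rewrite -(pmulr_lgt0 _ Lx); move: La; rewrite b0 mul0r subr0 => <-.
  have a1 : a = 1.
    by move: ab; rewrite b0 expr0n addr0 => /eqP; rewrite sqrf_eq1 => /orP[/eqP//|/eqP]; lra.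
  by rewrite a1 b0.
apply/val_inj/rowP => k; rewrite -(splitK k).
case: (fintype.split k) => j /=; have := yx j; rewrite c1 mul1r => -[E1 E2] //.
Qed.

(** Uniqueness: the cell of a point is the position of its last nonzero
    coordinate. *)
Lemma CP_partition (y : CP R m) : exists! i, open_cell (X := CP_cells R m) i y.
Proof.
have [v ->] := cp_class_surj y; have [i vi oi] := open_cell_exists v.
exists i; split => // i' /open_cell_last[vi' above'].
have [_ above] := open_cell_last oi.
apply/val_inj; apply/eqP; rewrite eqn_leq; apply/andP; split; rewrite leqNgt; apply/negP.
  by move=> /above'; apply/eqP.
by move=> /above; apply/eqP.
Qed.

Lemma CP_cells_CW : hausdorff_space (CP R m) -> is_CW (CP_cells R m).
Proof.
move=> hCP; apply: finite_CW => //.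
- exact: finite_finset.
- exact: CP_char_continuous.
- exact: CP_char_inj.
- exact: CP_partition.
- move=> i x bx; have [v vE vx] := CP_charE x.
  have [i' vi' oi'] := open_cell_exists v.
  exists i'; last by rewrite /= vE.
  suff : (i' < i)%N by move=> lt; 
    apply: (leq_ltn_trans (leq_add (leqnn i') (ltnW lt))); rewrite ltn_add2r.
  rewrite ltnNge leq_eqVlt; apply/negP => /orP[/eqP/val_inj ii'|lt].
    by move: vi'; rewrite -ii' vx cell_vec_last (bx : sqnorm _ = 1) subrr sqrtr0 eqxx.
  by move: vi'; rewrite vx cell_vec_above // eqxx.
Qed.

End complex_projective_cells.

(** * Attaching the cells of the ball bundle *)

Section stages.
Context {R : realType} {n : nat}.
Local Notation space := (@ambient R n).
Local Notation row := 'rV[quat R]_n.+1.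

Definition cp_embed (y : CP R (2 * n)) : space := line_point (\val (repr y)).

Lemma cp_embedE v : cp_embed (cp_class v) = line_point (\val v).
Proof.
have /cp_classP[c c0 ->] : cp_class (repr (cp_class v)) = cp_class v.
  exact: (reprK (cp_class v)).
by rewrite /cp_embed line_point_scale.
Qed.

Lemma cp_embed_continuous : continuous cp_embed.
Proof.
apply/quotient_continuous; rewrite (_ : _ \o _ = fun v => line_point (\val v)).
  exact: line_point_continuous.
by apply/funext => v; exact: cp_embedE.
Qed.

Lemma cp_embed_inj : injective cp_embed.
Proof.
move=> x y; have [v ->] := cp_class_surj x; have [w ->] := cp_class_surj y.
have v0 : \val v != 0 by exact: (set_valP v).
have w0 : \val w != 0 by exact: (set_valP w).
by rewrite !cp_embedE => /(line_point_inj v0 w0) /cp_classP.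
Qed.

Lemma cp_embed_realised : realised (cp_embed : CP_cells R (2 * n) -> space).
Proof.
split; [|exact: finite_finset|exact: cp_embed_continuous|exact: cp_embed_inj].
apply: CP_cells_CW.
exact: injective_hausdorff cp_embed_continuous cp_embed_inj ambient_hausdorff.
Qed.

(** The image of CP^(2n), see [range_cp_embed]. *)
Definition line_set : set space :=
  [set m | exists w : row, [/\ nsq w = 1, (w 0 ord_max).2 = 0 & m = ball_point qi w]].

Definition supported (k : nat) (w : row) :=
  forall b : 'I_n.+1, (k <= b)%N -> w 0 b = 0.

(** The ball bundle over HP^(k-1). *)
Definition bundle_set k : set space :=
  [set m | exists q (w : row), [/\ nsq w = 1, supported k w, imaginary q,
     qsq q <= 1 & m = ball_point q w]].

Lemma nsq1_neq0 (w : row) : nsq w = 1 -> w != 0.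
Proof. by move=> w1; rewrite -nsq_eq0 w1 oner_eq0. Qed.

Lemma complexify_neq0 (w : row) : nsq w = 1 -> (w 0 ord_max).2 = 0 ->
  complexify w != 0.
Proof.
move=> w1 wn; apply: contra_eq_neq (complexifyK wn) => ->.
by rewrite quaternify0 eq_sym nsq1_neq0.
Qed.

Lemma range_cp_embed : range cp_embed = line_set.
Proof.
rewrite eqEsubset; split=> [_ [y _ <-]|_ [w [w1 wn ->]]].
  have [v ->] := cp_class_surj y; rewrite cp_embedE.
  have v0 : quaternify (\val v) != 0 by apply: quaternify_neq0; exact: (set_valP v).
  exists (unitize (quaternify (\val v))); split => //; first exact: nsq_unitize.
  rewrite mxE [X in qreal _ * X](_ : _ = ((quaternify (\val v) 0 ord_max).1, 0) :> quat R).
    by rewrite /= mulr0 mul0r addr0.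
  by apply: quatP => //=; exact: quaternify_last.
pose v : nonzero_vec (cplx R) (2 * n).+1 :=
  exist _ (complexify w) (mem_set (complexify_neq0 w1 wn : nonzero_vec _ _ _)).
exists (cp_class v) => //.
by rewrite cp_embedE /line_point complexifyK // unitize_id.
Qed.

Lemma supported_last k (w : row) : (k <= n)%N -> supported k w -> w 0 ord_max = 0.
Proof. by move=> kn; apply. Qed.

(** The complex coordinates vanish from 2k on, so the complex line is in a
    cell of dimension at most 4k-2. *)
Lemma complex_line_skeleton k q (w : row) : (k <= n)%N -> (4 * k <= q.+1)%N ->
  nsq w = 1 -> supported k w ->
  skeleton (cp_embed : CP_cells R (2 * n) -> space) q (ball_point qi w).
Proof.
move=> kn kq w1 sw; have wn : (w 0 ord_max).2 = 0 by rewrite (supported_last kn sw).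
pose v : nonzero_vec (cplx R) (2 * n).+1 :=
  exist _ (complexify w) (mem_set (complexify_neq0 w1 wn : nonzero_vec _ _ _)).
have [i vi oi] := open_cell_exists v.
have ik : (i < 2 * k)%N.
  rewrite ltnNge; apply/negP => ki; move: vi; rewrite /= mxE.
  (* The complex coordinates 2a and 2a+1 belong to the quaternionic coordinate a. *)
  have i2 : (k <= (inord i./2 : 'I_n.+1))%N.
    by rewrite inordK; have := ltn_ord i; lia.
  by rewrite (sw _ i2) /=; case: ifP; rewrite eqxx.
exists i; first by rewrite /=; lia.
exists (cp_class v) => //.
by rewrite cp_embedE /line_point complexifyK // unitize_id.
Qed.

(** The invariant after the cells of dimension 3, 7, ..., 4k-1 have been
    attached. *)
Record stage (k : nat) (A : cell_space R) (r : A -> space) : Prop := Stage {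
  stage_realised : realised r;
  stage_range : range r = line_set `|`
    [set m | exists k', (k' < k)%N /\ exists2 x : 'rV[R]_(4 * k').+3,
       disk R _ x & m = cell_map k' x];
  stage_skeleton : forall q,
    skeleton (cp_embed : CP_cells R (2 * n) -> space) q `<=` skeleton r q;
  stage_cells : forall k' (x : 'rV[R]_(4 * k').+3), (k' < k)%N ->
    sqnorm x < 1 -> skeleton r (4 * k) (cell_map k' x)
}.

Lemma stage0 : stage 0 (cp_embed : CP_cells R (2 * n) -> space).
Proof.
split => //; [exact: cp_embed_realised| |by move=> q m].
rewrite range_cp_embed eqEsubset; split=> m; first by left.
by move=> [//|[k' [//]]].
Qed.

Lemma skeleton_mono (A : cell_space R) (r : A -> space) p q :
  (p <= q)%N -> skeleton r p `<=` skeleton r q.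
Proof. by move=> pq m [e de H]; exists e => //; exact: leq_trans pq. Qed.

Lemma supported_scale k u (w : row) : supported k w -> supported k (u *: w).
Proof. by move=> sw b kb; rewrite mxE sw // mulr0. Qed.

Lemma supported_lvec k v (t : R) : supported k.+1 (lvec n.+1 k v t).
Proof. by move=> b kb; rewrite mxE ltnNge (ltnW kb) /= gtn_eqF. Qed.

Lemma ball_point_unit_imaginary q (w : row) : imaginary q -> qsq q = 1 ->
  exists2 u, qsq u = 1 & ball_point q w = ball_point qi (u *: w).
Proof.
move=> iq q1; have [u u1 qE] := unit_imaginary_rotation iq q1.
by exists u; rewrite // ball_point_unit_scale // -qE.
Qed.

(** A point on the sphere of its ball is a complex line.  Any other point is in
    the cell given by the last nonzero coordinate of its quaternionic line. *)
Lemma bundle_skeleton k (A : cell_space R) (r : A -> space) : (k <= n)%N -> stage k r ->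
  bundle_set k `<=` skeleton r (4 * k).
Proof.
move=> kn sr _ [q [w [w1 sw iq q1 ->]]].
move: q1; rewrite le_eqVlt => /orP[/eqP q1|q1].
  have [u u1 ->] := ball_point_unit_imaginary w iq q1.
  apply: (stage_skeleton sr); apply: (complex_line_skeleton kn) => //.
    by rewrite nsq_scale u1 mul1r.
  exact: supported_scale.
have [k' wk' above] := last_nonzero (nsq1_neq0 w1).
have k'k : (k' < k)%N by rewrite ltnNge; apply: contra wk' => /sw ->.
have [u [v [t [u1 t0 wE _]]]] := lvec_normal wk' above.
have l1 : nsq (lvec n.+1 k' v t) = 1.
  by move: w1; rewrite wE nsq_scale u1 mul1r.
rewrite wE ball_point_unit_scale //.
have q1' : qsq (qconj u * q * u) = qsq q by rewrite !qsqM qsq_conj u1 mul1r mulr1.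
have := l1; rewrite nsq_lvec ?ltn_ord // => vt.
have [|x [dx <- ix]] := cell_map_surj (n := n) (erefl (4 * k').+3)
  (ltn_ord k') (imaginary_rotation u iq) _ (ltW t0) vt; first by rewrite q1' ltW.
by apply: (stage_cells sr) => //; apply: ix => //; rewrite q1'.
Qed.

Lemma line_set_norm m : line_set m -> \sum_a \sum_b qsq (m.2 a b) = 1.
Proof.
by move=> [w [w1 _ ->]]; rewrite sandwich_norm w1 expr1n mulr1 qsq_i.
Qed.

(** The interior of the new cell avoids CP^(2n) because |q| < 1, and the
    previous cells because the entry in position k of the projector is not
    zero.  Its boundary consists of complex lines and of points of the ball
    bundle over HP^(k-1). *)
Lemma stage_step k p (A : cell_space R) (r : A -> space) (a0 : A) :
  (k < n)%N -> p = (4 * k).+3 ->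
  stage k r ->
  exists2 phi : sphere R p -> A, continuous phi &
  exists r' : attach_cell phi -> space, stage k.+1 r'.
Proof.
move=> kn pE sr; have kn1 : (k < n.+1)%N by exact: ltnW.
have [||||phi cphi [r' [rr' ranger' sk' new']]] :=
  @attach_step R _ A r p (fun x => cell_map k (\val x)) a0 ambient_hausdorff
    (stage_realised sr).
- exact: cell_map_continuous.
- move=> x y; rewrite !inE => ix iy xy; apply/val_inj.
  exact: (cell_map_inj pE kn1 ix iy).
- move=> x ix; have [t0 q1] := cell_interior pE ix.
  rewrite (stage_range sr) => -[/line_set_norm|[k' [k'k [y dy]]]].
    rewrite sandwich_norm cell_lvec_norm ?expr1n ?mulr1 //; last exact: set_valP.
    by move=> E; rewrite E ltxx in q1.
  move=> /(congr1 fst)/(congr1 (fun M : 'M[quat R]_n.+1 => M (Ordinal kn1) (Ordinal kn1))).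
  rewrite /= sandwich_lvec_last // mulr1 => /esym/eqP.
  rewrite [sandwich _ _ _ _](_ : _ = 0); last first.
    by apply/eqP; rewrite sandwich_diag_eq0 supported_lvec.
  by rewrite eq_sym -qsq_eq0 qsq_real !expf_eq0 /= gt_eqF.
- move=> x bx; have dx : disk R p (\val x) by exact: set_valP.
  have [q1|t0] := cell_boundary pE bx.
    have [u u1 E] := ball_point_unit_imaginary
      (lvec n.+1 k (cell_vec k (\val x)) (Num.sqrt (ell (\sum_(a < k) qsq (qcoord (\val x) a))
                                             (qsq (icoord (\val x) k)))))
      (cell_dir_imaginary k (\val x)) q1.
    rewrite /cell_map E; apply: (stage_skeleton sr).
    apply: (@complex_line_skeleton k.+1) => //; first by rewrite pE; lia.
      by rewrite nsq_scale u1 mul1r cell_lvec_norm.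
    by apply: supported_scale; exact: supported_lvec.
  apply: (@skeleton_mono _ _ (4 * k)); first by rewrite pE; lia.
  apply: (bundle_skeleton (ltnW kn) sr).
  exists (cell_dir k (\val x)); eexists; split; last by [].
  + exact: cell_lvec_norm.
  + move=> b kb; rewrite t0 mxE ltnNge kb /=; case: ifP => // _.
  + exact: cell_dir_imaginary.
  + exact: cell_dir_le1.
exists phi => //; exists r'; split => //.
- rewrite ranger' (stage_range sr) -setUA; congr (_ `|` _).
  rewrite eqEsubset; split=> m.
    move=> [[k' [k'k H]]|[x _ <-]]; first by exists k'; split => //; exact: ltnW.
    exists k; split => //; move: x; rewrite {}pE => x.
    by exists (\val x) => //; exact: set_valP.
  move=> [k' [k'k [x dx ->]]]; have [k'k1|k'k1] := ltnP k' k.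
    by left; exists k'; split => //; exists x.
  have kk' : k' = k by lia.
  right; subst p; subst k'.
  by exists (exist _ x (mem_set dx)).
- move=> q m H; apply: sk'; exact: (stage_skeleton sr).
- move=> k' x k'k ix; have [k'k1|k'k1] := ltnP k' k.
    apply: sk'; apply: (@skeleton_mono _ _ (4 * k)); first by lia.
    exact: (stage_cells sr).
  have kk' : k' = k by lia.
  subst p; subst k'.
  have dx : disk R (4 * k).+3 x by exact: ltW.
  apply: (new' _ (exist _ x (mem_set dx))) => //; lia.
Qed.

Lemma stages j k (A : cell_space R) (r : A -> space) (a0 : A) : (k + j = n)%N -> stage k r ->
  exists2 X : cell_space R, attached A [seq (4 * l - 1)%N | l <- iota k.+1 j] X &
  exists r' : X -> space, stage n r'.
Proof.
elim: j k A r a0 => [|j IHj] k A r a0 /= kj sr.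
  exists A; first exact: attached_nil.
  by exists r; rewrite -kj addn0.
have kn : (k < n)%N by lia.
have pE : (4 * k.+1 - 1 = (4 * k).+3)%N by lia.
have [phi cphi [r' sr']] := stage_step a0 kn pE sr.
have kj' : (k.+1 + j = n)%N by lia.
have [X XA H] := IHj k.+1 (attach_cell phi) r'
  (adjunction_pi phi (attach_inl (4 * k.+1 - 1) a0)) kj' sr'.
by exists X => //; exact: attached_cons cphi XA.
Qed.

Lemma stage_rangeE (A : cell_space R) (r : A -> space) : stage n r ->
  range r = line_set `|` bundle_set n.
Proof.
move=> sr; rewrite eqEsubset; split.
  rewrite (stage_range sr) => m [|[k' [k'n [x dx ->]]]]; first by left.
  have kn1 : (k' < n.+1)%N by exact: ltnW.
  right; exists (cell_dir k' x); eexists; split; last by [].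
  - exact: cell_lvec_norm.
  - by move=> b nb; apply: supported_lvec; exact: leq_trans nb.
  - exact: cell_dir_imaginary.
  - exact: cell_dir_le1.
move=> m [lm|bm]; first by rewrite (stage_range sr); left.
by have [e _ [y _ <-]] := bundle_skeleton (leqnn n) sr bm; exists y.
Qed.

End stages.

(** * Quaternionic projective space *)

Section quaternionic_projective_space.
Context {R : realType} {n : nat}.
Local Notation row := 'rV[quat R]_n.+1.
Local Notation vec := (nonzero_vec (quat R) n.+1).

Definition hp_class (v : vec) : HP R n :=
  \pi_{eq_quot line_equiv (quat R) n.+1} v.

Definition hp_embed (y : HP R n) : 'M[quat R]_n.+1 :=
  sandwich 1 (unitize (\val (repr y))).

Definition projector_set : set 'M[quat R]_n.+1 :=
  [set P | exists2 w : row, nsq w = 1 & P = sandwich 1 w].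

Lemma hp_class_surj (y : HP R n) : exists v, y = hp_class v.
Proof. by exists (repr y); rewrite /hp_class reprK. Qed.

Lemma hp_classP (v w : vec) :
  hp_class v = hp_class w <-> exists2 c : quat R, c != 0 & \val w = c *: \val v.
Proof.
split=> [/eqmodP/asboolP[c cu ->]|[c c0 wE]]; first by exists c.
by apply/eqmodP/asboolP; exists c.
Qed.

Lemma sandwich1_unitize_scale (c : quat R) (w : row) : c != 0 ->
  sandwich 1 (unitize (c *: w)) = sandwich 1 (unitize w).
Proof.
by move=> c0; rewrite unitize_scale // sandwich_unit_scale // qsq_unit_part.
Qed.

Lemma hp_embedE v : hp_embed (hp_class v) = sandwich 1 (unitize (\val v)).
Proof.
have /hp_classP[c c0 ->] : hp_class (repr (hp_class v)) = hp_class v.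
  exact: (reprK (hp_class v)).
by rewrite /hp_embed sandwich1_unitize_scale.
Qed.

Lemma hp_embed_continuous : continuous hp_embed.
Proof.
apply/quotient_continuous.
rewrite (_ : _ \o _ = fun v => sandwich 1 (unitize (\val v))); last first.
  by apply/funext => v; exact: hp_embedE.
have cv := @set_val_continuous _ (nonzero_vec (quat R) n.+1).
apply: sandwich_continuous; first exact: cst_continuous.
move=> a; apply: unitize_continuous => [b|v]; last exact: (set_valP v).
exact: (comp_continuous (@entry_continuous _ _ _ _ b) cv).
Qed.

Lemma hp_embed_inj : injective hp_embed.
Proof.
move=> x y; have [v ->] := hp_class_surj x; have [w ->] := hp_class_surj y.
have v0 : \val v != 0 by exact: (set_valP v).
have w0 : \val w != 0 by exact: (set_valP w).
rewrite !hp_embedE => /(sandwich1_inj (nsq_unitize v0) (nsq_unitize w0))[u u1 uE].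
apply/hp_classP.
exists (qreal (Num.sqrt (nsq (\val w))) * u * qreal (Num.sqrt (nsq (\val v)))^-1).
  rewrite -qsq_eq0 !qsqM !qsq_real u1 mulr1 mulf_eq0 !expf_eq0 /= invr_eq0.
  by rewrite negb_or !sqrt_nsq_neq0.
by rewrite -!scalerA -/(unitize _) -uE unitizeK.
Qed.

Lemma range_hp_embed : range hp_embed = projector_set.
Proof.
rewrite eqEsubset; split=> [_ [y _ <-]|_ [w w1 ->]].
  have [v ->] := hp_class_surj y; rewrite hp_embedE.
  by exists (unitize (\val v)) => //; apply: nsq_unitize; exact: (set_valP v).
exists (hp_class (exist _ w (mem_set (nsq1_neq0 w1 : nonzero_vec _ _ _)))) => //.
by rewrite hp_embedE unitize_id.
Qed.

(** Here [t] may vanish, so that one closed 4n-disk covers the whole space. *)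
Lemma lvec_form (w : row) : nsq w = 1 -> exists u v t,
  [/\ qsq u = 1, 0 <= t, w = u *: lvec n.+1 n v t &
      ((w 0 ord_max).2 = 0 -> u * qi = qi * u)].
Proof.
move=> w1; have [wn|wn] := eqVneq (w 0 ord_max) 0.
  exists 1, (fun a => w 0 (inord a)), 0; split; rewrite ?qsq1 ?mul1r ?mulr1 //.
  rewrite scale1r; apply/rowP => b; rewrite mxE; case: (ltngtP b n) => bn.
  - by congr (fun_of_matrix w 0 _); apply/val_inj; rewrite /= inordK // ltnS ltnW.
  - by have := ltn_ord b; rewrite ltnS leqNgt bn.
  - by rewrite (_ : b = ord_max) //; exact/val_inj.
have above (b : 'I_n.+1) : (@ord_max n < b)%N -> w 0 b = 0.
  by move=> /= nb; have := ltn_ord b; rewrite ltnS leqNgt nb.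
have [u [v [t [u1 t0 wE uC]]]] := lvec_normal wn above.
by exists u, v, t; split => //; exact: ltW.
Qed.

Definition top_vec (x : 'rV[R]_(4 * n)) : row :=
  lvec n.+1 n (qcoord x) (Num.sqrt (1 - sqnorm x)).

Lemma top_vec_norm x : disk R _ x -> nsq (top_vec x) = 1.
Proof.
move=> dx; rewrite nsq_lvec // sqr_sqrtr ?subr_ge0 //.
by rewrite (@sqnorm_quat _ n) // addrC subrK.
Qed.

(** HP^n is the image of a closed disk, by its top cell. *)
Lemma top_vec_surj v t : 0 <= t -> nsq (lvec n.+1 n v t) = 1 ->
  exists2 x, disk R (4 * n) x & top_vec x = lvec n.+1 n v t.
Proof.
move=> t0; rewrite nsq_lvec // => vt; pose x := pack (4 * n) n v 0.
have xv a : (a < n)%N -> qcoord x a = v a by move=> an; rewrite qcoord_pack.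
have xN : sqnorm x = 1 - t ^+ 2.
  rewrite (@sqnorm_quat _ n) // -vt addrK; apply: eq_bigr => a _.
  by rewrite xv.
exists x; first by rewrite /disk /= xN gerBl sqr_ge0.
rewrite /top_vec xN opprB addrC subrK sqrtr_sqr ger0_norm //.
by apply/rowP => b; rewrite !mxE; case: ifP => // bn; rewrite xv.
Qed.

Lemma top_vec_continuous a : continuous (fun x => top_vec x 0 a).
Proof.
apply: lvec_continuous; first by move=> j _; exact: qcoord_continuous.
exact: (sqrtr_continuous (addr_continuous (@cst_continuous _ R 1)
  (oppr_continuous (@sqnorm_continuous R (4 * n))))).
Qed.

Lemma hp_compact : compact [set: HP R n].
Proof.
have nz (x : disk R (4 * n)) : top_vec (\val x) \in nonzero_vec (quat R) n.+1.
  by rewrite inE; apply: (nsq1_neq0 (top_vec_norm (set_valP x))).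
pose f (x : disk R (4 * n)) : HP R n := hp_class (exist _ (top_vec (\val x)) (nz x)).
have -> : [set: HP R n] = f @` [set: disk R (4 * n)].
  rewrite eqEsubset; split=> // y _; have [v ->] := hp_class_surj y.
  have v0 : \val v != 0 by exact: (set_valP v).
  have [u [c [t [u1 t0 uE _]]]] := lvec_form (nsq_unitize v0).
  have l1 : nsq (lvec n.+1 n c t) = 1.
    by have := nsq_unitize v0; rewrite uE nsq_scale u1 mul1r.
  have [x dx xE] := top_vec_surj t0 l1.
  exists (exist _ x (mem_set dx)) => //; apply: hp_embed_inj.
  rewrite !hp_embedE /= unitize_id; last by rewrite xE.
  by rewrite uE sandwich_unit_scale // xE.
apply: continuous_compact; last exact: diskT_compact.
apply: continuous_subspaceT.
have cpi : continuous hp_class by exact: pi_continuous.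
apply: (comp_continuous cpi); apply: set_type_continuous.
apply: matrix_continuous => i b; rewrite ord1.
exact: (comp_continuous (@top_vec_continuous b) (@set_val_continuous _ _)).
Qed.

End quaternionic_projective_space.

(** * The radial flow *)

Section radial_flow.
Context {R : realType} {n : nat}.
Local Notation space := (@ambient R n).
Local Notation row := 'rV[quat R]_n.+1.
Implicit Types (v : nat -> quat R) (tau : R).

Definition vnorm2 v : R := \sum_(a < n) qsq (v a).

(** The vector [v] of the closed unit ball of H^n, which parametrizes the
    4n-cell of CP^(2n), is multiplied by 1 + tau.  As long as its length N is
    at most 1 it gives a complex line.  Beyond that the line stays on the
    boundary of the cell, and the excess N - 1 measures how far the point has
    moved from the sphere bundle towards the center of its ball. *)
Definition flow v tau : space :=
  let N := (1 + tau) * Num.sqrt (vnorm2 v) in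
  let c := (Num.max 1 N)^-1 * (1 + tau) in
  ball_point (qreal (1 - Num.max 0 (N - 1)) * qi)
     (lvec n.+1 n (fun a => qreal c * v a) (Num.sqrt (1 - c ^+ 2 * vnorm2 v))).

Lemma vnorm2_ge0 v : 0 <= vnorm2 v.
Proof. by apply: sumr_ge0 => a _; exact: qsq_ge0. Qed.

Lemma lvec_ext v v' (t : R) : (forall a, (a < n)%N -> v a = v' a) ->
  lvec n.+1 n v t = lvec n.+1 n v' t.
Proof. by move=> vv'; apply/rowP => b; rewrite !mxE; case: ifP => // /vv'. Qed.

Lemma flow_ext v v' tau : (forall a, (a < n)%N -> v a = v' a) ->
  flow v tau = flow v' tau.
Proof.
move=> vv'; have NE : vnorm2 v = vnorm2 v'.
  by apply: eq_bigr => a _; rewrite vv'.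
rewrite /flow NE; congr ball_point; apply: lvec_ext => a an; by rewrite vv'.
Qed.

Lemma flow_inside v tau : 0 <= 1 + tau -> (1 + tau) ^+ 2 * vnorm2 v <= 1 ->
  flow v tau = ball_point qi (lvec n.+1 n (fun a => qreal (1 + tau) * v a)
                 (Num.sqrt (1 - (1 + tau) ^+ 2 * vnorm2 v))).
Proof.
move=> t0 tv1; have N1 : (1 + tau) * Num.sqrt (vnorm2 v) <= 1.
  rewrite -(@ler_pXn2r _ 2) ?nnegrE ?mulr_ge0 ?sqrtr_ge0 //.
  by rewrite exprMn sqr_sqrtr ?vnorm2_ge0 // expr1n.
rewrite /flow (max_l N1) invr1 mul1r max_l ?subr_le0 // subr0 qreal1 mul1r.
by [].
Qed.

Lemma flow_outside v tau : 0 <= 1 + tau -> 1 <= (1 + tau) ^+ 2 * vnorm2 v ->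
  flow v tau = ball_point (qreal (2 - (1 + tau) * Num.sqrt (vnorm2 v)) * qi)
    (lvec n.+1 n (fun a => qreal (Num.sqrt (vnorm2 v))^-1 * v a) 0).
Proof.
move=> t0 tv1; set S := Num.sqrt (vnorm2 v).
have S2 : S ^+ 2 = vnorm2 v by rewrite sqr_sqrtr // vnorm2_ge0.
have S0 : 0 <= S by exact: sqrtr_ge0.
have N1 : 1 <= (1 + tau) * S.
  rewrite -(@ler_pXn2r _ 2) ?nnegrE ?mulr_ge0 //.
  by rewrite exprMn S2 expr1n.
have t0' : 1 + tau != 0 by apply: contraTneq N1 => ->; rewrite mul0r ler10.
have S0' : S != 0 by apply: contraTneq N1 => ->; rewrite mulr0 ler10.
have cE : ((1 + tau) * S)^-1 * (1 + tau) = S^-1 by rewrite invfM mulrAC mulVf ?mul1r.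
rewrite /flow -/S (max_r N1) cE max_r ?subr_ge0 //.
rewrite (_ : 1 - (_ - 1) = 2 - (1 + tau) * S); last by ring.
by rewrite -S2 exprVn mulVf ?expf_eq0 //= subrr sqrtr0.
Qed.

Lemma flow0 v (t : R) : 0 <= t -> nsq (lvec n.+1 n v t) = 1 ->
  flow v 0 = ball_point qi (lvec n.+1 n v t).
Proof.
move=> t0; rewrite nsq_lvec // -/(vnorm2 v) => vt.
have vE : vnorm2 v = 1 - t ^+ 2 by rewrite -vt addrK.
rewrite flow_inside ?addr0 // ?expr1n ?mul1r vE ?gerBl ?sqr_ge0 //.
rewrite opprB addrC subrK sqrtr_sqr ger0_norm //; congr ball_point.
by apply: lvec_ext => a _; rewrite qreal1 mul1r.
Qed.

(** The flow on the boundary of the cell agrees with the contraction [shrink]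
    of the ball bundle, so that the two can be glued. *)
Lemma flow_boundary v tau : 0 <= tau -> vnorm2 v = 1 ->
  flow v tau = ball_point (qreal (1 - tau) * qi) (lvec n.+1 n v 0).
Proof.
move=> t0 v1; rewrite flow_outside ?v1 ?mulr1 ?sqrtr1 ?invr1; last 2 first.
- by rewrite addr_ge0.
- by rewrite exprn_ege1 // lerDl.
rewrite mulr1; congr ball_point; last by apply: lvec_ext => a _; rewrite qreal1 mul1r.
by congr (qreal _ * _); ring.
Qed.

Lemma flow_mem v tau : 0 <= tau <= 1 -> vnorm2 v <= 1 ->
  (line_set `|` bundle_set n) (flow v tau).
Proof.
move=> /andP[t0 t1] v1; have t2 : 0 <= 1 + tau by rewrite addr_ge0.
have [in1|out1] := leP ((1 + tau) ^+ 2 * vnorm2 v) 1.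
  left; rewrite flow_inside //; eexists; split; last by [].
    rewrite nsq_lvec // sqr_sqrtr ?subr_ge0 //.
    under eq_bigr => a _ do rewrite qsqM qsq_real.
    by rewrite -mulr_sumr -/(vnorm2 v) addrC subrK.
  by rewrite mxE ltnn eqxx.
right; rewrite (flow_outside t2 (ltW out1)); do 2!eexists; split; last by [].
- rewrite nsq_lvec //; under eq_bigr => a _ do rewrite qsqM qsq_real.
  rewrite -mulr_sumr -/(vnorm2 v) exprVn sqr_sqrtr ?vnorm2_ge0 //.
  rewrite mulVf ?expr0n ?addr0 //; apply: contraTneq out1 => ->.
  by rewrite mulr0 ltr10.
- by move=> b nb; rewrite mxE ltnNge nb /=; case: ifP.
- exact/imaginary_real/imaginary_i.
- rewrite qsqM qsq_real qsq_i mulr1.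
  have S0 := sqrtr_ge0 (vnorm2 v).
  have S1 : Num.sqrt (vnorm2 v) <= 1 by rewrite -sqrtr1 ler_wsqrtr.
  have N1 : 1 <= (1 + tau) * Num.sqrt (vnorm2 v).
    rewrite -(@ler_pXn2r _ 2) ?nnegrE ?mulr_ge0 //.
    by rewrite exprMn sqr_sqrtr ?vnorm2_ge0 // expr1n ltW.
  by rewrite expr_le1 //; nra.
Qed.

Lemma flow_continuous :
  continuous (fun xt : 'rV[R]_(4 * n) * R => flow (qcoord xt.1) xt.2).
Proof.
have c1 : continuous (fun xt : 'rV[R]_(4 * n) * R => xt.1) by move=> x; exact: cvg_fst.
have c2 : continuous (fun xt : 'rV[R]_(4 * n) * R => xt.2) by move=> x; exact: cvg_snd.
have cq a := comp_continuous (@qcoord_continuous R (4 * n) a) c1.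
have cN : continuous (fun xt : 'rV[R]_(4 * n) * R => vnorm2 (qcoord xt.1)).
  by apply: sum_continuous => a; exact: (qsq_continuous (cq a)).
have ct := addr_continuous (@cst_continuous _ R 1) c2.
have cM := mulr_continuous ct (sqrtr_continuous cN).
have cmax := maxr_continuous (@cst_continuous _ R 1) cM.
have max0 (xt : 'rV[R]_(4 * n) * R) :
    Num.max 1 ((1 + xt.2) * Num.sqrt (vnorm2 (qcoord xt.1))) != 0.
  by rewrite gt_eqF // lt_max ltr01.
have cc := mulr_continuous (invr_continuous cmax max0) ct.
have cmu := addr_continuous (@cst_continuous _ R 1) (oppr_continuous
  (maxr_continuous (@cst_continuous _ R 0) (addr_continuous cM (@cst_continuous _ R (- 1))))).
apply: ball_point_continuous.
  exact: (qmul_continuous (qreal_continuous cmu) (@cst_continuous _ (quat R) qi)).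
move=> a; apply: lvec_continuous.
  by move=> j _; exact: (qmul_continuous (qreal_continuous cc) (cq j)).
exact: (sqrtr_continuous (addr_continuous (@cst_continuous _ R 1)
  (oppr_continuous (mulr_continuous (@exprr_continuous _ _ _ 2 cc) cN)))).
Qed.

End radial_flow.

(** * Contraction onto quaternionic projective space *)

Section retraction.
Context {R : realType} {n : nat}.
Local Notation space := (@ambient R n).
Local Notation row := 'rV[quat R]_n.+1.
Local Notation mat := 'M[quat R]_n.+1.
Implicit Types (P Q : mat) (tau : R) (m : space).

(** The vector [v], given the projector of a row (v, t) with t > 0. *)
Definition recover P (a : nat) : quat R :=
  qreal (Num.sqrt (complex.Re (P ord_max ord_max).1))^-1 * P ord_max (inord a).

(** The homothety of ratio 1 - tau in every ball. *)
Definition shrink tau m : space :=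
  (m.1, \matrix_(a, b) (qreal (1 - tau) * m.2 a b)).

(** The entry in position n of the projector vanishes exactly on the ball
    bundle over HP^(n-1).  That bundle is shrunk, and the remaining cell
    follows the flow. *)
Definition collar m tau : space :=
  if m.1 ord_max ord_max == 0 then shrink tau m else flow (recover m.1) tau.

(** At time 1 the balls have been shrunk to their centers, so that the result
    is a function of the projector alone ([collar1]). *)
Definition zero_section P : space := collar (P, 0) 1.

Lemma shrink_ball_point tau q (w : row) :
  shrink tau (ball_point q w) = ball_point (qreal (1 - tau) * q) w.
Proof.
by congr pair; apply/matrixP => a b; rewrite [LHS]mxE sandwich_real.
Qed.

Lemma shrink1 P Q Q' : shrink 1 (P, Q) = shrink 1 (P, Q').
Proof.
by congr pair; apply/matrixP => a b; rewrite !mxE subrr qreal0 !mul0r.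
Qed.

Lemma collar1 m : collar m 1 = zero_section m.1.
Proof.
rewrite /zero_section /collar /=; case: ifP => // _.
by rewrite [m]surjective_pairing (shrink1 _ m.2 0).
Qed.

Lemma collar_fst P Q Q' tau : (collar (P, Q) tau).1 = (collar (P, Q') tau).1.
Proof. by rewrite /collar /=; case: ifP. Qed.

Lemma recover_lvec v (t : R) a : 0 < t -> (a < n)%N ->
  recover (sandwich 1 (lvec n.+1 n v t)) a = v a.
Proof.
move=> t0 an; rewrite /recover sandwich_lvec_last // mulr1 /= sqrtr_sqr gtr0_norm //.
have aK : (inord a : 'I_n.+1) = a :> nat by rewrite inordK // ltnS ltnW.
rewrite sandwich1_lvec_row // mxE aK an mulrA -qrealM.
by rewrite mulVf ?gt_eqF // qreal1 mul1r.
Qed.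

Lemma vnorm2_qcoord (x : 'rV[R]_(4 * n)) : vnorm2 (n := n) (qcoord x) = sqnorm x.
Proof. by rewrite (@sqnorm_quat _ n). Qed.

Lemma flow_top x : disk R (4 * n) x -> flow (n := n) (qcoord x) 0 = ball_point qi (top_vec x).
Proof. by move=> dx; apply: flow0; rewrite ?sqrtr_ge0 // top_vec_norm. Qed.

(** The second alternative for [Q] covers the case where only the projector
    is given, at time 1. *)
Lemma collar_flow x Q tau : disk R (4 * n) x -> 0 <= tau ->
  Q = (flow (n := n) (qcoord x) 0).2 \/ tau = 1 ->
  collar ((flow (qcoord x) 0).1, Q) tau = flow (qcoord x) tau.
Proof.
move=> dx tau0 Qtau; rewrite flow_top // in Qtau *.
rewrite /collar /= sandwich_diag_eq0 mxE ltnn eqxx -qsq_eq0 qsq_real sqrf_eq0.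
case: ifPn => [/eqP t0|t0].
  have x1 : sqnorm x = 1.
    by move/eqP: t0; rewrite sqrtr_eq0 subr_le0 => x1; apply: le_anti; rewrite x1 dx.
  rewrite flow_boundary ?vnorm2_qcoord // -shrink_ball_point /top_vec t0.
  by case: Qtau => [->|->]; [rewrite /top_vec t0|exact: shrink1].
apply: flow_ext => a an; apply: recover_lvec => //.
by rewrite lt_def t0 sqrtr_ge0.
Qed.

Lemma line_set_flow m : line_set m ->
  exists2 x, disk R (4 * n) x & m = flow (qcoord x) 0.
Proof.
move=> [w [w1 wn ->]]; have [u [v [t [u1 t0 wE uC]]]] := lvec_form w1.
have l1 : nsq (lvec n.+1 n v t) = 1 by move: w1; rewrite wE nsq_scale u1 mul1r.
have [x dx xE] := top_vec_surj t0 l1; exists x => //.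
by rewrite flow_top // xE wE ball_point_commute // uC.
Qed.

Lemma projector_set_flow P : projector_set P ->
  exists2 x, disk R (4 * n) x & P = (flow (n := n) (qcoord x) 0).1.
Proof.
move=> [w w1 ->]; have [u [v [t [u1 t0 wE _]]]] := lvec_form w1.
have l1 : nsq (lvec n.+1 n v t) = 1 by move: w1; rewrite wE nsq_scale u1 mul1r.
have [x dx xE] := top_vec_surj t0 l1; exists x => //.
by rewrite flow_top // xE wE /= sandwich_unit_scale.
Qed.

Lemma bundle_set_diag m : bundle_set n m -> m.1 ord_max ord_max = 0.
Proof.
move=> [q [w [w1 sw iq q1 ->]]].
by apply/eqP; rewrite sandwich_diag_eq0 sw.
Qed.

Local Notation total := (line_set `|` bundle_set n : set space).

Lemma total_fst m : total m -> projector_set m.1.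
Proof.
by move=> [[w [w1 _ ->]]|[q [w [w1 _ _ _ ->]]]]; exists w.
Qed.

Lemma vnorm2_disk x : disk R (4 * n) x -> vnorm2 (n := n) (qcoord x) <= 1.
Proof. by rewrite vnorm2_qcoord. Qed.

Lemma collar_line x tau : disk R (4 * n) x -> 0 <= tau ->
  collar (flow (qcoord x) 0) tau = flow (qcoord x) tau.
Proof.
move=> dx tau0; rewrite [X in collar X](surjective_pairing _).
by apply: collar_flow => //; left.
Qed.

Lemma collar_total m tau : total m -> 0 <= tau <= 1 -> total (collar m tau).
Proof.
move=> Tm t01; have [t0 t1] := andP t01.
case: Tm => [/line_set_flow[x dx ->]|bm].
  by rewrite collar_line //; apply: flow_mem => //; exact: vnorm2_disk.
rewrite /collar (bundle_set_diag bm) eqxx.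
case: bm => [q [w [w1 sw iq q1 ->]]]; rewrite shrink_ball_point; right.
exists (qreal (1 - tau) * q), w; split => //; first exact: imaginary_real.
rewrite qsqM qsq_real mulr_ile1 ?sqr_ge0 ?qsq_ge0 //.
by rewrite expr_le1 ?subr_ge0 // gerBl.
Qed.

Lemma collar0 m : total m -> collar m 0 = m.
Proof.
case=> [/line_set_flow[x dx ->]|bm]; first by rewrite collar_line.
rewrite /collar (bundle_set_diag bm) eqxx.
by case: bm => [q [w [_ _ _ _ ->]]]; rewrite shrink_ball_point subr0 qreal1 mul1r.
Qed.

Lemma zero_section_flow x : disk R (4 * n) x ->
  zero_section (flow (n := n) (qcoord x) 0).1 = flow (qcoord x) 1.
Proof. by move=> dx; apply: collar_flow => //; right. Qed.

Lemma zero_section_total P : projector_set P -> total (zero_section P).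
Proof.
move=> /projector_set_flow[x dx ->]; rewrite zero_section_flow //.
by apply: flow_mem; rewrite ?ler01 ?lexx //; exact: vnorm2_disk.
Qed.

Lemma flow0_continuous :
  continuous (fun x : 'rV[R]_(4 * n) => flow (n := n) (qcoord x) 0).
Proof.
have ci : continuous (fun x : 'rV[R]_(4 * n) => (x, 0 : R)).
  by apply: pair_continuous; [move=> x; exact: cvg_id|exact: cst_continuous].
exact: (comp_continuous (@flow_continuous R n) ci).
Qed.

Lemma flow1_continuous :
  continuous (fun x : 'rV[R]_(4 * n) => flow (n := n) (qcoord x) 1).
Proof.
have ci : continuous (fun x : 'rV[R]_(4 * n) => (x, 1 : R)).
  by apply: pair_continuous; [move=> x; exact: cvg_id|exact: cst_continuous].
exact: (comp_continuous (@flow_continuous R n) ci).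
Qed.

Lemma zero_section_continuous : {within projector_set, continuous zero_section}.
Proof.
apply: (@continuous_subspaceW _ _ _
  ((fun x => (flow (n := n) (qcoord x) 0).1) @` disk R (4 * n))).
  by move=> P /projector_set_flow[x dx ->]; exists x.
apply: compact_image_continuous.
- exact/matrix_hausdorff/quat_hausdorff.
- exact: disk_compact.
- apply: continuous_subspaceT.
  exact: (comp_continuous (@fst_continuous _ _) flow0_continuous).
- apply: eq_in_within_continuous flow1_continuous => x dx /=.
  exact: zero_section_flow.
Qed.

Local Notation I := (`[0, 1]%classic : set R).

Lemma cylinder_compact : compact (disk R (4 * n) `*` I).
Proof. by apply: compact_setX; [exact: disk_compact|exact: segment_compact]. Qed.

(** The domain is covered by two closed sets: the image of the compact
    cylinder over the top cell, and the points over HP^(n-1). *)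
Lemma collar_continuous :
  {within total `*` I, continuous (fun mt : space * R => collar mt.1 mt.2)}.
Proof.
pose f (xt : 'rV[R]_(4 * n) * R) : space * R := (flow (qcoord xt.1) 0, xt.2).
have cf : continuous f.
  apply: pair_continuous; last exact: snd_continuous.
  exact: (comp_continuous flow0_continuous (@fst_continuous _ _)).
have hU : hausdorff_space (space * R)%type.
  by apply: prod_hausdorff; [exact: ambient_hausdorff|exact: Rhausdorff].
pose S : set (space * R) := [set mt : space * R | (mt.1.1 : mat) ord_max ord_max = 0].
apply: (@continuous_subspaceW _ _ _ ((f @` (disk R (4 * n) `*` I)) `|` S)).
  move=> [m t] [/= [/line_set_flow[x dx ->]|bm] It]; first by left; exists (x, t).
  by right; exact: bundle_set_diag.
have cS : continuous (fun mt : space * R => (mt.1.1 : mat) ord_max ord_max).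
  have c1 := comp_continuous (@fst_continuous mat mat) (@fst_continuous space R).
  exact: (comp_continuous (@entry_continuous _ _ _ ord_max ord_max) c1).
apply: withinU_continuous.
- apply: compact_closed => //; apply: continuous_compact cylinder_compact.
  exact: continuous_subspaceT.
- apply: (@closed_comp _ _ _ [set q : quat R | q = 0]).
    by move=> mt _; exact: cS.
  exact: (accessible_closed_set1 (hausdorff_accessible quat_hausdorff)).
- apply: compact_image_continuous => //; first exact: cylinder_compact.
    exact: continuous_subspaceT.
  apply: eq_in_within_continuous (@flow_continuous R n) => -[x t] [dx /= It] /=.
  by apply: collar_line => //; move: It; rewrite in_itv /= => /andP[].
- apply: (@eq_in_within_continuous _ _ _ (fun mt => shrink mt.2 mt.1)).
    by move=> mt Smt; rewrite /collar Smt eqxx.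
  apply: pair_continuous.
    exact: (comp_continuous (@fst_continuous mat mat) (@fst_continuous space R)).
  apply: matrix_continuous => a b.
  rewrite (_ : (fun mt => _) = fun mt : space * R => qreal (1 - mt.2) * (mt.1.2 : mat) a b); last first.
    by apply/funext => mt; rewrite mxE.
  have c1 := comp_continuous (@snd_continuous mat mat) (@fst_continuous space R).
  have c2 := comp_continuous (@entry_continuous _ _ _ a b) c1.
  have c3 := addr_continuous (@cst_continuous _ R 1) (oppr_continuous (@snd_continuous space R)).
  exact: (qmul_continuous (qreal_continuous c3) c2).
Qed.

Lemma collar_fst_continuous :
  {within projector_set `*` I,
    continuous (fun Pt : mat * R => (collar (Pt.1, 0) Pt.2).1)}.
Proof.
pose f (xt : 'rV[R]_(4 * n) * R) : mat * R := ((flow (qcoord xt.1) 0).1, xt.2).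
have cf : continuous f.
  apply: pair_continuous; last exact: snd_continuous.
  apply: (comp_continuous (@fst_continuous _ _)).
  exact: (comp_continuous flow0_continuous (@fst_continuous _ _)).
apply: (@continuous_subspaceW _ _ _ (f @` (disk R (4 * n) `*` I))).
  by move=> [P t] [/= /projector_set_flow[x dx ->] It]; exists (x, t).
apply: compact_image_continuous.
- apply: prod_hausdorff; last exact: Rhausdorff.
  exact/matrix_hausdorff/quat_hausdorff.
- exact: cylinder_compact.
- exact: continuous_subspaceT.
(* The projector does not depend on [Q], so [Q] can be chosen on the flow. *)
- have cfl := comp_continuous (@fst_continuous mat mat) (@flow_continuous R n).
  apply: eq_in_within_continuous cfl => -[x t] [dx /= It] /=.
  rewrite (collar_fst _ _ (flow (qcoord x) 0).2) collar_flow //; last by left.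
  by move: It; rewrite in_itv /= => /andP[].
Qed.

End retraction.

Section homotopy_equivalence.
Context {R : realType} {n : nat} (X : cell_space R) (r : X -> @ambient R n).
Hypothesis rX : realised r.
Hypothesis rangeX : range r = line_set `|` bundle_set n.

(** The collar starts from the identity and ends with the composite, whereas
    the homotopies go from the composite to the identity; hence the reversal
    of time [back]. *)
Lemma retraction_homotopy_equivalence (x0 : X) (y0 : HP R n) :
  exists f : HP R n -> X, homotopy_equivalence R f.
Proof.
have [_ _ cr ir] := rX.
have hM := @matrix_hausdorff _ n.+1 n.+1 (@quat_hausdorff R).
have [j rK cj] := compact_inverse x0 ambient_hausdorff (realised_compact rX) cr ir.
have [i hK ci] := compact_inverse y0 hM hp_compact hp_embed_continuous hp_embed_inj.
rewrite rangeX in cj; rewrite range_hp_embed in ci.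
have hP (y : HP R n) : projector_set (hp_embed y) by rewrite -range_hp_embed; exact: imageT.
have rT x : (line_set `|` bundle_set n) (r x) by rewrite -rangeX; exact: imageT.
have jK m : (line_set `|` bundle_set n) m -> r (j m) = m.
  by rewrite -rangeX => -[x _ <-]; rewrite rK.
have iK (P : 'M[quat R]_n.+1) : projector_set P -> hp_embed (i P) = P.
  by rewrite -range_hp_embed => -[y _ <-]; rewrite hK.
pose f y := j (zero_section (hp_embed y)).
pose g x := i (r x).1.
have cs := comp_within_continuous hp_embed_continuous hP zero_section_continuous.
have cf : continuous f := comp_within_continuous cs (fun y => zero_section_total (hP y)) cj.
have cr1 := comp_continuous (@fst_continuous _ _) cr.
have cg : continuous g := comp_within_continuous cr1 (fun x => total_fst (rT x)) ci.
pose back (t : R) : R := 1 - t.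
have back01 (t : R) : (`[0, 1]%classic : set R) t -> (`[0, 1]%classic : set R) (back t).
  by rewrite /back /= !in_itv /= => /andP[t0 t1]; apply/andP; split; lra.
have back_continuous (T : topologicalType) (U : topologicalType) (h : T -> U) :
    continuous h -> continuous (fun xt : T * R => (h xt.1, back xt.2)).
  move=> ch; apply: pair_continuous.
    exact: (comp_continuous ch (@fst_continuous _ _)).
  exact: (addr_continuous (@cst_continuous _ R 1)
    (oppr_continuous (@snd_continuous _ _))).
exists f; split => //; exists g; split => //.
- pose A : set (HP R n * R) := [set: HP R n] `*` `[0, 1]%classic.
  have m1 (yt : HP R n * R) : A yt ->
      (projector_set `*` (`[0, 1]%classic : set R)) (hp_embed yt.1, back yt.2).
    by move=> [_ /= It]; split => //=; exact: back01.
  have m2 (yt : HP R n * R) : A yt ->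
      projector_set (collar (hp_embed yt.1, 0) (back yt.2)).1.
    move=> [_ /= It]; have [x dx ->] := projector_set_flow (hP yt.1).
    rewrite (collar_fst _ _ (flow (qcoord x) 0).2) -surjective_pairing.
    apply/total_fst/collar_total; last by have := back01 _ It; rewrite /= in_itv.
    by apply: flow_mem; rewrite ?lexx ?ler01 //; exact: vnorm2_disk.
  have c1 := continuous_subspaceT (A := A) (back_continuous _ _ _ hp_embed_continuous).
  have c2 := within_comp_continuous c1 m1 collar_fst_continuous.
  have c3 := within_comp_continuous c2 m2 ci.
  exists (fun yt => i (collar (hp_embed yt.1, 0) (back yt.2)).1).
  split; first exact: c3.
  + by move=> y; rewrite /back subr0 /= /g /f jK //; exact: zero_section_total.
  + move=> y /=; rewrite /back subrr; have [x dx yx] := projector_set_flow (hP y).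
    rewrite yx (collar_fst _ _ (flow (qcoord x) 0).2) -surjective_pairing.
    by rewrite collar_line // -yx hK.
- pose A : set (X * R) := [set: X] `*` `[0, 1]%classic.
  have m1 (xt : X * R) : A xt ->
      ((line_set `|` bundle_set n) `*` (`[0, 1]%classic : set R)) (r xt.1, back xt.2).
    by move=> [_ /= It]; split; [exact: rT|exact: back01].
  have m2 (xt : X * R) : A xt ->
      (line_set `|` bundle_set n) (collar (r xt.1) (back xt.2)).
    move=> [_ /= It]; apply: collar_total => //.
    by have := back01 _ It; rewrite /= in_itv.
  have c1 := continuous_subspaceT (A := A) (back_continuous _ _ _ cr).
  have c2 := within_comp_continuous c1 m1 collar_continuous.
  have c3 := within_comp_continuous c2 m2 cj.
  exists (fun xt => j (collar (r xt.1) (back xt.2))).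
  split; first exact: c3.
  + move=> x; rewrite /back subr0 collar1 /= /f /g iK //.
    exact: total_fst.
  + by move=> x; rewrite /back subrr /= collar0 ?rK.
Qed.

End homotopy_equivalence.

Theorem proposition6p3 (R : realType) (n : nat) (n_ge1 : (1 <= n)%N) :
  exists X : cell_space R,
    [/\ attached (CP_cells R (2 * n)) [seq (4 * k - 1)%N | k <- iota 1 n] X,
        is_CW X &
        exists f : HP R n -> X, homotopy_equivalence R f].
Proof.
have d0 : disk R (4 * n) 0 by exact: disk_center.
have a0 : CP R (2 * n).
  exact: (@CP_char R (2 * n) ord0 (exist _ 0 (mem_set (@disk_center R (0 + 0))))).
have y0 : HP R n.
  exact: (hp_class (exist _ (top_vec (0 : 'rV[R]_(4 * n)))
    (mem_set (nsq1_neq0 (top_vec_norm d0) : nonzero_vec _ _ _)))).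
have [X XA [r sr]] := @stages R n n 0 (CP_cells R (2 * n)) cp_embed a0 (add0n n) stage0.
have rX := stage_realised sr; have [cwX _ _ _] := rX.
exists X; split => //.
have [x0 _ _] : range r (ball_point qi (top_vec (0 : 'rV[R]_(4 * n)))).
  rewrite (stage_rangeE sr); left; eexists; split; last by [].
    exact: top_vec_norm.
  by rewrite mxE ltnn eqxx.
exact: (retraction_homotopy_equivalence rX (stage_rangeE sr) x0 y0).
Qed.
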